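(* There is a constant $Q_0$ such that the following holds. For every $\epsilon>0$ there is a constant $C_\epsilon>0$, depending only on $\epsilon$, such that for every integer $Q\ge Q_0$ satisfying $$ \operatorname{rad}(Q) \leq \exp \left(2 (\log Q)^{3/4}\right), $$ every primitive Dirichlet character $\chi \pmod Q$, and every real $y > 3$, $$ \left| L(s_y, \chi) \right| \le C_\epsilon (\log Q)^{3/4 + \epsilon}, $$ where $s_y := 1 + \frac{1}{\log y}$.
   Context: The radical of $Q$ is $\operatorname{rad}(Q) := \prod_{p \mid Q} p$, the product of the distinct primes dividing $Q$. $L(s,\chi)=\sum_{n\ge 1}\chi(n)n^{-s}$ is the Dirichlet $L$-function (for $\operatorname{Re}(s)>1$). *)

(* Defs.v *)
(* MathComp + MathComp-Analysis; the complex numbers are R[i] for R : realType. *)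
From HB Require Import structures.
From mathcomp Require Import all_boot all_order all_algebra.
From mathcomp Require Import all_classical all_reals all_analysis.
From mathcomp Require Import complex.

Set Implicit Arguments.
Unset Strict Implicit.
Unset Printing Implicit Defensive.

Import Order.TTheory GRing.Theory Num.Theory.
Import numFieldNormedType.Exports.

Local Open Scope classical_set_scope.
Local Open Scope ring_scope.
Local Open Scope complex_scope.

Definition radical (n : nat) : nat := (\prod_(p <- primes n) p)%N.

(* Dirichlet characters are functions on the integers, extended by zero to
   the integers not coprime to the modulus. *)
Record dirichlet_character (R : realType) (Q : nat) (chi : int -> R[i]) : Prop :=
  DirichletCharacter {
    dchar_periodic : forall m n : int, (m = n %[mod Q])%Z -> chi m = chi n;
    dcharM : forall m n : int, chi (m * n) = chi m * chi n;
    dchar_eq0 : forall n : int, (chi n == 0) = ~~ coprimez n Q }.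

(* No character of a proper divisor of Q induces chi; the case d = 1 makes the
   principal character imprimitive for Q > 1. *)
Definition primitive_character (R : realType) (Q : nat) (chi : int -> R[i]) : Prop :=
  dirichlet_character Q chi /\
  forall (d : nat) (psi : int -> R[i]),
    (d %| Q)%N -> dirichlet_character d psi ->
    (forall n : int, coprimez n Q -> chi n = psi n) -> d = Q.

Definition cexp (R : realType) (z : R[i]) : R[i] :=
  (expR (complex.Re z))%:C * (cos (complex.Im z) +i* sin (complex.Im z)).

(* n ^ s = exp (s log n) for n >= 1 *)
Definition natcpow (R : realType) (n : nat) (s : R[i]) : R[i] :=
  cexp (s * (ln (n%:R : R))%:C).

(* The sum over n >= 1 (index shifted by one); meaningful for Re s > 1.  The
   cast gives R[i] the topology of its norm. *)
Definition dirichlet_L (R : realType) (s : R[i]) (chi : int -> R[i]) : R[i] :=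
  limn (series ((fun n : nat => chi n.+1 * natcpow n.+1 (- s))
                : nat -> (R[i] : numFieldType))).

(* Main.v *)
(* Write l = ln Q.  By partial summation it suffices to save a factor l^(-1/4) in the
   sums of chi over all intervals of a single length x with ln x ~ l^(3/4 + eps): the
   terms with n up to about x contribute O(ln x) to L, and those with n > Q are controlled
   by periodicity.

   Choose d, divisible by all primes dividing Q, with Q | d^(k+1) and k ~ l^(1/4 - eps)
   (possible because rad Q is small), and shift n to n + d u.  For n prime to Q, a
   product of values chi (n + d u_i) depends, up to a unimodular factor, only on the
   coefficients of prod_i (1 + u_i X) modulo X^(k+1), evaluated at d / n.  A dual large
   sieve over n reduces the problem to two facts.
   - Coincidences of such truncated products are rare.  This is Linnik's q-adic proof of
     Vinogradov's mean value theorem, with the polynomials themselves in place of power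
     sums: the shifts are organised in O(k^2) levels, the variables of a level being
     multiples of a fixed power of an auxiliary prime q.
   - For different n modulo D ~ d the functions of the coefficients are orthogonal: as a
     function of a single coefficient of X^j with Q | d^(2j) they are additive characters,
     and by primitivity of chi they cannot agree for two consecutive j.
   This gives a saving of a power of q >= l, provided ln x is large compared to
   k^3 ln q. *)

Require Import Defs.
From HB Require Import structures.
From mathcomp Require Import all_boot all_order all_algebra.
From mathcomp Require Import all_classical all_reals all_analysis.
From mathcomp Require Import complex.
From mathcomp Require Import cyclic.
From mathcomp Require Import zify ring lra.

Set Implicit Arguments.
Unset Strict Implicit.
Unset Printing Implicit Defensive.

Import Order.TTheory GRing.Theory Num.Theory.
Import numFieldNormedType.Exports.

Local Open Scope ring_scope.

(** * Collisions between products of linear polynomials *)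

(** Two constraints of equal strength fix [k]. Up to powers of the radical [D] is [Q^(1/(k+1))], and
    the exceptional set of the sieve carries a factor [q] to a power of order [k^3]; so [ln Q / k]
    has to dominate [k^3 ln q], and also [ln (rad Q)]. As [ln (rad Q) <= 2 (ln Q)^(3/4)], both stop
    just below [k = (ln Q)^(1/4)]. The block length is at most [d^2 q^2], with logarithm of order
    [ln Q / k]: this is the exponent 3/4. The coefficients of [X^j] that separate different [n] come
    from a narrow window: additivity needs [2 j > k], and passing from a congruence modulo [Q] to
    one modulo [D] after division by [d^j] needs [3 j < 2 (k+1)]. For the two largest such [j] a
    full period has length about [d^(k/3)] and the coefficient ranges up to about [q^(2kW/3)]. Hence
    [q^W] must exceed about [d^(1/2)], yet stay well below [D] for the exceptional [n] to be few;
    [d^(2/3)] lies between. A product of values of [chi] is governed by one polynomial only if all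
    factors share the same [n], so the large sums of all levels must be found around one common
    centre. *)

Lemma PoszX (n m : nat) : (n ^ m)%N%:Z = n%:Z ^+ m.
Proof. by rewrite -!natz natrX. Qed.

Definition lin_prod (k : nat) (y : 'I_k -> int) : {poly int} :=
  \prod_(i < k) (1 + (y i)%:P * 'X).

Definition dilate (p : nat) (f : {poly int}) : {poly int} :=
  f \Po (p%:Z%:P * 'X).

Definition eq_trunc (K : nat) (f g : {poly int}) : bool :=
  take_poly K f == take_poly K g.

Lemma eq_truncP K (f g : {poly int}) :
  reflect (forall j, (j < K)%N -> f`_j = g`_j) (eq_trunc K f g).
Proof.
apply: (iffP eqP) => [E j jK|E].
  by have := congr1 (fun h : {poly int} => h`_j) E; rewrite !coef_take_poly jK.
by apply/polyP => j; rewrite !coef_take_poly; case: ifP => // /E.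
Qed.

Lemma eq_trunc_refl K f : eq_trunc K f f.
Proof. exact: eqxx. Qed.

Lemma eq_trunc_sym K f g : eq_trunc K f g = eq_trunc K g f.
Proof. exact: eq_sym. Qed.

Lemma eq_trunc_trans K f g h : eq_trunc K f g -> eq_trunc K g h -> eq_trunc K f h.
Proof. by move=> /eqP fg /eqP gh; apply/eqP; rewrite fg. Qed.

Lemma eq_truncM K f f' g g' :
  eq_trunc K f f' -> eq_trunc K g g' -> eq_trunc K (f * g) (f' * g').
Proof.
move=> /eq_truncP ff /eq_truncP gg; apply/eq_truncP => j jK; rewrite !coefM.
apply: eq_bigr => i _; rewrite ff ?gg //; first by rewrite (leq_ltn_trans (leq_subr _ _)).
by rewrite (leq_ltn_trans _ jK) // -ltnS.
Qed.

Lemma eq_trunc_mulI K (A f g : {poly int}) :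
  A`_0 = 1 -> eq_trunc K (A * f) (A * g) -> eq_trunc K f g.
Proof.
move=> A0 /eq_truncP E; apply/eq_truncP => j.
elim/ltn_ind: j => j IH jK; have := E j jK.
rewrite !coefM !big_ord_recl A0 !mul1r subn0 => /eqP.
rewrite (_ : \sum_(i < j) _ = \sum_(i < j) A`_(lift ord0 i) * g`_(j - lift ord0 i)).
  by rewrite (inj_eq (addIr _)) => /eqP.
apply: eq_bigr => i _; congr (_ * _); apply: IH; rewrite lift0; first by have := ltn_ord i; lia.
by apply: leq_ltn_trans jK; rewrite leq_subr.
Qed.

Lemma eq_trunc_inv K (H : {poly int}) :
  H`_0 = 1 -> exists2 B : {poly int}, eq_trunc K (H * B) 1 & B`_0 = 1.
Proof.
move=> H0; set G := - drop_poly 1 H.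
have HE : H = 1 - G * 'X.
  rewrite -[LHS](poly_take_drop 1) mulNr opprK; congr (_ + _).
  by apply/polyP=> -[|j]; rewrite coef_take_poly coef1 ?H0.
have E : H * \sum_(i < K) (G * 'X) ^+ i = 1 - (G * 'X) ^+ K.
  by rewrite HE -[RHS]opprB [in RHS]subrX1 -[RHS]mulNr opprB.
(* The last term vanishes modulo [X^K]; it makes the constant coefficient 1 also for [K = 0], where
   the geometric sum is empty. *)
exists (\sum_(i < K) (G * 'X) ^+ i + (G * 'X) ^+ K).
  apply/eq_truncP => j jK; rewrite mulrDr E exprMn mulrA coefD coefB !coefMXn jK.
  by rewrite subr0 addr0.
have -> : \sum_(i < K) (G * 'X) ^+ i + (G * 'X) ^+ K = \sum_(i < K.+1) (G * 'X) ^+ i.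
  by rewrite big_ord_recr.
rewrite big_ord_recl coefD expr0 coef1 eqxx coef_sum big1 ?addr0 // => i _.
by rewrite exprMn coefMXn.
Qed.

Lemma coef_dilate p f j : (dilate p f)`_j = f`_j * p%:Z ^+ j.
Proof.
rewrite /dilate coef_comp_poly.
under eq_bigr => i _ do
  rewrite exprMn -rmorphXn /= coefCM coefXn.
case: (ltnP j (size f)) => js.
  rewrite (bigD1 (Ordinal js)) //= eqxx mulr1 big1 ?addr0 // => i.
  by rewrite -val_eqE /= eq_sym => /negPf ->; rewrite !mulr0.
rewrite nth_default // mul0r big1 // => i _.
by rewrite (_ : (j == i) = false) ?mulr0 //; apply/negbTE; have := ltn_ord i; lia.
Qed.

Lemma dilateM p f g : dilate p (f * g) = dilate p f * dilate p g.
Proof. exact: comp_polyM. Qed.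

Lemma eq_trunc_dilate K p f g : (0 < p)%N ->
  eq_trunc K (dilate p f) (dilate p g) = eq_trunc K f g.
Proof.
move=> p0; apply/eq_truncP/eq_truncP => E j /E; rewrite ?coef_dilate; last by move=> ->.
by apply: mulIf; rewrite expf_neq0 //; lia.
Qed.

Lemma horner_dilate p f x : (dilate p f).[x] = f.[p%:Z * x].
Proof. by rewrite /dilate horner_comp !hornerE. Qed.

Lemma lin_prod0 k (y : 'I_k -> int) : (lin_prod y)`_0 = 1.
Proof.
rewrite /lin_prod; elim/big_ind: _ => [|f g f0 g0|i _]; first by rewrite coef1.
  by rewrite coef0M f0 g0.
by rewrite !coefE /= mulr0 addr0.
Qed.

Lemma size_lin_prod k (y : 'I_k -> int) : (size (lin_prod y) <= k.+1)%N.
Proof.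
elim: k y => [|k IH] y; first by rewrite /lin_prod big_ord0 size_poly1.
rewrite /lin_prod big_ord_recr /=.
apply: leq_trans (size_polyMleq _ _) _.
have H1 : (size (1 + (y ord_max)%:P * 'X : {poly int})%R <= 2)%N.
  rewrite (leq_trans (size_polyD _ _)) // geq_max size_poly1 /=.
  by rewrite mul_polyC (leq_trans (size_scale_leq _ _)) // size_polyX.
rewrite -subn1 leq_subLR add1n -[k.+3]addn2.
exact: leq_add (IH (fun i => y (widen_ord (leqnSn k) i))) H1.
Qed.

(** The left side is the reversal of [lin_prod y], whose roots are the integers [- y i];
    [hensel_unique] evaluates it at such a root. *)
Lemma lin_prod_rev k (y : 'I_k -> int) (t : int) :
  \sum_(m < k.+1) (lin_prod y)`_m * t ^+ (k - m) = \prod_(i < k) (t + y i).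
Proof.
elim: k y => [|k IH] y.
  by rewrite big_ord1 /lin_prod !big_ord0 coef1 mulr1.
rewrite [RHS]big_ord_recr /= -(IH (y \o widen_ord (leqnSn k))) /=.
set f := lin_prod (y \o _).
have -> : lin_prod y = f + (y ord_max) *: f * 'X.
  rewrite /lin_prod big_ord_recr /= -/(lin_prod _) -mul_polyC -/f.
  by rewrite /f /lin_prod /=; ring.
rewrite mulrDr !big_distrl /=.
under eq_bigr => m _ do rewrite coefD coefMX coefZ mulrDl.
rewrite big_split /=; congr (_ + _).
  rewrite big_ord_recr /= [f`_k.+1]nth_default ?size_lin_prod // mul0r addr0.
  apply: eq_bigr => m _; rewrite -mulrA -exprSr subSn //.
  by rewrite -ltnS.
rewrite big_ord_recl /= mul0r add0r; apply: eq_bigr => m _.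
by rewrite /bump /= add1n subSS; ring.
Qed.

Lemma coprimez_prod (p : int) (I : finType) (P : pred I) (F : I -> int) :
  (forall i, P i -> coprimez p (F i)) -> coprimez p (\prod_(i | P i) F i).
Proof.
move=> H; elim/big_ind: _ => //; first by rewrite coprimezE coprimen1.
by move=> x y; rewrite coprimezMr => -> ->.
Qed.

(** At [t = - y' l] the reversed product of [y'] vanishes, so that of [y] is divisible by [p ^ e].
    Its factors with [i != l] are prime to [p], which leaves [y l - y' l]. *)
Lemma hensel_unique (p e k : nat) (y y' : 'I_k -> int) :
  (forall i l, i != l -> coprimez p (y i - y' l)) ->
  (forall j, (p%:Z ^+ e %| (lin_prod y)`_j - (lin_prod y')`_j)%Z) ->
  forall l, (p%:Z ^+ e %| y l - y' l)%Z.
Proof.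
move=> Hc Hd l.
have H0 : \prod_(i < k) (- y' l + y' i) = 0.
  by rewrite (bigD1 l) //= addNr mul0r.
have : (p%:Z ^+ e %| \prod_(i < k) (- y' l + y i))%Z.
  rewrite -[X in (_ %| X)%Z]subr0 -H0 -!lin_prod_rev -sumrB.
  apply: rpred_sum => m _.
  by rewrite -mulrBl dvdz_mulr.
rewrite (bigD1 l) //= mulrC Gauss_dvdzr => [|]; first by rewrite addrC.
apply: coprimez_prod => i il; by rewrite coprimezXl // addrC Hc.
Qed.

Lemma sum_ord_ltn M L : (\sum_(j < M) (j < L) = minn M L)%N.
Proof.
elim: M => [|M IH]; first by rewrite big_ord0 min0n.
by rewrite big_ord_recr /= IH; lia.
Qed.

Lemma card_box k M (L : 'I_k -> nat) :
  (#|[set f : {ffun 'I_k -> 'I_M} | [forall j, (f j < L j)%N]]| <= \prod_j L j)%N.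
Proof.
have -> : #|[set f : {ffun 'I_k -> 'I_M} | [forall j, (f j < L j)%N]]|
    = (\prod_(j < k) \sum_(i < M) (i < L j))%N.
  rewrite bigA_distr_bigA -sum1_card big_mkcond /=; apply: eq_bigr => f _.
  rewrite inE; case: forallP => [H|H].
    by rewrite big1 // => j _; rewrite H.
  have /existsP[j jL] : [exists j, ~~ (f j < L j)%N].
    by rewrite -negb_forall; apply/forallP.
  by rewrite (bigD1 j) //= (negPf jL).
by apply: leq_prod => j _; rewrite sum_ord_ltn geq_minr.
Qed.

Definition level_var (q N k : nat) (c : {ffun 'I_k -> 'I_q})
  (z : {ffun 'I_k -> 'I_N}) (i : 'I_k) : int := (c i + q * z i)%N.

(* The quotient of the two products has its coefficient of ['X^j] divisible by [p ^ j],
   [p = q ^ w], so [lin_prod (level_var c z)] takes at most [p ^ 'C(k, 2)] values modulo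
   [p ^ k]; each of them determines [level_var c z] modulo [p ^ k]. *)
Lemma compat_card (q w k W : nat) (c : {ffun 'I_k -> 'I_q}) (A : {poly int})
    (S : {set {ffun 'I_k -> 'I_(q ^ W.-1)}}) :
  prime q -> injective c -> (0 < w)%N -> (k * w <= W)%N ->
  (forall z, z \in S -> exists H H' : {poly int}, [/\ H`_0 = 1, H'`_0 = 1 &
     eq_trunc k.+1 (lin_prod (level_var c z) * dilate (q ^ w) H)
                   (A * dilate (q ^ w) H')]) ->
  (#|S| <= (q ^ w) ^ 'C(k, 2) * (q ^ (W - k * w)) ^ k)%N.
Proof.
move=> q_pr c_inj w0 kwW HS.
set p := (q ^ w)%N; have p0 : (0 < p)%N by rewrite expn_gt0 prime_gt0.
have q0 := prime_gt0 q_pr.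
have [R HR] : exists R : {ffun 'I_k -> 'I_(q ^ W.-1)} -> {poly int}, forall z,
    z \in S -> (R z)`_0 = 1 /\
      eq_trunc k.+1 (lin_prod (level_var c z)) (A * dilate p (R z)).
  apply: (@fin_all_exists _ (fun=> {poly int}) (fun z r => z \in S -> r`_0 = 1 /\
      eq_trunc k.+1 (lin_prod (level_var c z)) (A * dilate p r))) => z.
  have [zS|] := boolP (z \in S); last by exists 0.
  have [H [H' [H0 H0' E]]] := HS z zS.
  have [B HB B0] := eq_trunc_inv k.+1 H0.
  exists (H' * B) => _; split; first by rewrite coef0M H0' B0.
  rewrite dilateM mulrA -[X in eq_trunc _ X]mulr1.
  apply: eq_trunc_trans (eq_truncM E (eq_trunc_refl _ (dilate p B))).
  rewrite -mulrA -dilateM; apply: eq_truncM (eq_trunc_refl _ _) _.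
  rewrite eq_trunc_sym -[X in eq_trunc _ _ X](_ : dilate p 1 = _) ?eq_trunc_dilate //.
  by rewrite /dilate comp_polyC.
(* Dilation multiplies coefficient [j.+1] of [R z] by [p ^ j.+1], so modulo [p ^ k] only its residue
   modulo [p ^ (k - j.+1)] counts. *)
pose m j := (p ^ (k - j.+1))%N.
(* Hensel fixes [c j + q * z j] modulo [q ^ (k * w)], hence [z j] with one power of [q] less;
   [code2] records the remaining part of [z j]. *)
pose M := (q ^ (k * w).-1)%N.
pose code1 z : {ffun 'I_k -> 'I_(p ^ k).+1} :=
  [ffun j : 'I_k => inord `|((R z)`_j.+1 %% (m j)%:Z)%Z|%N].
pose code2 (z : {ffun 'I_k -> 'I_(q ^ W.-1)}) : {ffun 'I_k -> 'I_(q ^ W.-1).+1} :=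
  [ffun j : 'I_k => inord (z j %/ M)%N].
have m0 j : (0 < m j)%N by rewrite expn_gt0 p0.
have mlt z j : (`|((R z)`_j.+1 %% (m j)%:Z)%Z| < m j)%N.
  by have := ltz_pmod ((R z)`_j.+1) (m0 j : 0 < (m j)%:Z);
     have := modz_ge0 ((R z)`_j.+1) (lt0r_neq0 (m0 j : 0 < (m j)%:Z)); lia.
have mp j : (m j < (p ^ k).+1)%N by rewrite ltnS leq_pexp2l // leq_subr.
have code1E z j : code1 z j = `|((R z)`_j.+1 %% (m j)%:Z)%Z|%N :> nat.
  by rewrite ffunE inordK // (ltn_trans (mlt z j)).
have code2E z j : code2 z j = (z j %/ M)%N :> nat.
  by rewrite ffunE inordK // ltnS (leq_trans (leq_div _ _)) // ltnW.
have inj : {in S &, injective (fun z => (code1 z, code2 z))}.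
  move=> z z' zS z'S [/ffunP E1 /ffunP E2].
  have [R0 RE] := HR z zS; have [R0' RE'] := HR z' z'S.
  have Hd j : (p%:Z ^+ k %| (lin_prod (level_var c z))`_j - (lin_prod (level_var c z'))`_j)%Z.
    have [jk|jk] := ltnP j k.+1; last first.
      by rewrite !nth_default ?subrr ?dvdz0 // (leq_trans (size_lin_prod _)).
    rewrite (eq_truncP _ _ _ RE j jk) (eq_truncP _ _ _ RE' j jk) !coefM -sumrB.
    apply: rpred_sum => i _; rewrite -mulrBr dvdz_mull // !coef_dilate -mulrBl.
    have ij : (j - i <= k)%N by rewrite (leq_trans (leq_subr _ _)).
    case: (j - i)%N ij => [_|n nk]; first by rewrite R0 R0' subrr mul0r dvdz0.
    rewrite -(subnK nk) exprD dvdz_mul //.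
    have := congr1 (@nat_of_ord _) (E1 (Ordinal nk)); rewrite !code1E /= => E.
    rewrite /m /= in E; rewrite -[_ ^+ _]/(_ ^+ _) -eqz_mod_dvd.
    have e : p%:Z ^+ (k - n.+1) = (p ^ (k - n.+1))%N by rewrite PoszX.
    rewrite e; apply/eqP.
    have g x : 0 <= (x %% (p ^ (k - n.+1))%N%:Z)%Z.
      by apply: modz_ge0; have := m0 n; rewrite /m; lia.
    by have := g (R z)`_n.+1; have := g (R z')`_n.+1; lia.
  have pk : p%:Z ^+ k = q%:Z ^+ (k * w) by rewrite /p PoszX -exprM mulnC.
  rewrite pk in Hd.
  have cop i l : i != l -> coprimez q (level_var c z i - level_var c z' l).
    move=> il; rewrite coprimezE /= prime_coprime //; apply/negP => D.
    have {}D : (q%:Z %| (c i)%:Z - (c l)%:Z)%Z.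
      have : (q%:Z %| level_var c z i - level_var c z' l)%Z by [].
      rewrite (_ : level_var c z i - level_var c z' l =
        (c i)%:Z - (c l)%:Z + q%:Z * ((z i)%:Z - (z' l)%:Z)); last first.
        by rewrite /level_var !PoszD !PoszM; ring.
      by rewrite rpredDr // dvdz_mulr.
    have : c i = c l.
      apply: val_inj; move: D; rewrite -eqz_mod_dvd => /eqP.
      by rewrite !modz_nat !modn_small // => -[].
    by move/c_inj/eqP; rewrite (negPf il).
  have Hh := hensel_unique cop Hd.
  apply/ffunP => l; apply: val_inj.
  have kw0 : (0 < k * w)%N by rewrite muln_gt0 w0 andbT (leq_ltn_trans _ (ltn_ord l)).
  have := Hh l; rewrite (_ : level_var c z l - level_var c z' l =
      q%:Z * ((z l)%:Z - (z' l)%:Z)); last first.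
    by rewrite /level_var !PoszD !PoszM; ring.
  rewrite -(prednK kw0) exprS dvdz_mul2l; last by lia.
  rewrite -eqz_mod_dvd -PoszX => /eqP.
  rewrite !modz_nat => -[E3].
  have := congr1 (@nat_of_ord _) (E2 l); rewrite !code2E => E4.
  by rewrite /= (divn_eq (z l) M) (divn_eq (z' l) M) E4 /M E3.
rewrite -(card_in_imset inj).
pose B1 := [set f : {ffun 'I_k -> 'I_(p ^ k).+1} | [forall j : 'I_k, (f j < m j)%N]].
pose B2 := [set f : {ffun 'I_k -> 'I_(q ^ W.-1).+1} |
   [forall j : 'I_k, (f j < q ^ (W - k * w))%N]].
apply: (@leq_trans #|finset.setX B1 B2|).
  apply/subset_leq_card/fintype.subsetP => _ /imsetP[z zS ->].
  rewrite finset.in_setX !inE; apply/andP; split; apply/forallP => j.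
    by rewrite code1E.
  rewrite code2E ltn_divLR ?expn_gt0 ?q0 // -expnD.
  apply: leq_trans (ltn_ord _) _; rewrite leq_pexp2l //.
  have k0 : (0 < k * w)%N by rewrite muln_gt0 w0 andbT (leq_ltn_trans _ (ltn_ord j)).
  lia.
rewrite cardsX leq_mul //; first apply: leq_trans (card_box _ _) _.
  rewrite -expn_sum leq_pexp2l // (reindex_inj rev_ord_inj) /=.
  rewrite (eq_bigr (fun i : 'I_k => nat_of_ord i)) => [|i _]; last by have := ltn_ord i; lia.
  by rewrite -(big_mkord xpredT id) bin2_sum.
by apply: leq_trans (card_box _ _) _; rewrite prod_nat_const card_ord.
Qed.

(** * Counting coincidences level by level *)

Definition collisions K (hs : seq {poly int}) : nat :=
  (\sum_(a <- hs) \sum_(b <- hs) eq_trunc K a b)%N.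

Lemma sum_count (T : eqType) (U s : seq T) (F : T -> nat) :
  uniq U -> {subset s <= U} ->
  (\sum_(a <- s) F a = \sum_(v <- U) count_mem v s * F v)%N.
Proof.
move=> Uu sU.
under [RHS]eq_bigr => v _ do rewrite -sum1_count big_distrl /= big_mkcond /=.
rewrite exchange_big /= !big_seq; apply: eq_bigr => a /sU aU.
rewrite (bigD1_seq a) //= eqxx mul1n big1 ?addn0 // => v.
by rewrite eq_sym => /negPf ->.
Qed.

(** In terms of the multiplicities of a value in [s] and in [t] this is [2 m n <= m^2 + n^2], summed
    over all values. *)
Lemma pair_collisions (T : eqType) (s t : seq T) :
  ((\sum_(a <- s) \sum_(b <- t) (a == b)).*2 <=
   \sum_(a <- s) \sum_(b <- s) (a == b) + \sum_(a <- t) \sum_(b <- t) (a == b))%N.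
Proof.
pose U := undup (s ++ t).
have Uu : uniq U by exact: undup_uniq.
have sU : {subset s <= U} by move=> x xs; rewrite mem_undup mem_cat xs.
have tU : {subset t <= U} by move=> x xs; rewrite mem_undup mem_cat xs orbT.
have cE (r : seq T) a : (\sum_(b <- r) (a == b) = count_mem a r)%N.
  by rewrite -sum1_count [RHS]big_mkcond /=; apply: eq_bigr => b _; rewrite eq_sym; case: eqP.
have E (s1 s2 : seq T) : {subset s1 <= U} ->
    (\sum_(a <- s1) \sum_(b <- s2) (a == b) = \sum_(v <- U) count_mem v s1 * count_mem v s2)%N.
  by move=> sub; rewrite (sum_count _ Uu sub); apply: eq_bigr => v _; rewrite cE.
rewrite !E // -big_split -mul2n big_distrr /= leq_sum // => v _.
exact: nat_Cauchy.
Qed.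

Lemma pair_collisions_trunc K (s t : seq {poly int}) :
  ((\sum_(a <- s) \sum_(b <- t) eq_trunc K a b).*2 <= collisions K s + collisions K t)%N.
Proof.
have := pair_collisions [seq take_poly K a | a <- s] [seq take_poly K a | a <- t].
have E (s1 s2 : seq {poly int}) : (\sum_(a <- [seq take_poly K a | a <- s1])
    \sum_(b <- [seq take_poly K b | b <- s2]) (a == b) =
    \sum_(a <- s1) \sum_(b <- s2) eq_trunc K a b)%N.
  by rewrite big_map; apply: eq_bigr => a _; rewrite big_map.
by rewrite !E.
Qed.

Definition level_step (q k w W : nat) (c : {ffun 'I_k -> 'I_q})
    (hs : seq {poly int}) : seq {poly int} :=
  [seq lin_prod (level_var c z) * dilate (q ^ w) h |
     z <- enum {ffun 'I_k -> 'I_(q ^ W.-1)}, h <- hs].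

(* [W] is the exponent of [q] bounding the variables that remain; the dilation by [q ^ w]
   makes all variables of the later levels multiples of [q ^ w]. *)
Fixpoint level_polys (q k W : nat) (ws : seq nat) (cs : seq {ffun 'I_k -> 'I_q}) :
    seq {poly int} :=
  if ws is w :: ws' then if cs is c :: cs' then
    level_step w W c (level_polys (W - w) ws' cs')
  else [:: 1] else [:: 1].

Fixpoint valid_levels (k W : nat) (ws : seq nat) : bool :=
  if ws is w :: ws' then [&& 0 < w, k * w <= W & valid_levels k (W - w) ws']%N
  else (0 < W)%N.

Lemma level_polys0 q k W ws (cs : seq {ffun 'I_k -> 'I_q}) h :
  h \in level_polys W ws cs -> h`_0 = 1.
Proof.
elim: ws W cs h => [|w ws IH] W [|c cs] h /=; try by rewrite inE => /eqP ->; rewrite coef1.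
case/allpairsP => -[z g] /= [_ gin ->]; rewrite coef0M lin_prod0 coef_dilate.
by rewrite (IH _ _ _ gin) !mulr1.
Qed.

(** For fixed [z] and [z'] the coincidences are those between two families indexed by [hs]. Each
    family has exactly the coincidences of [hs] within itself, since dilation and multiplication by
    a series with constant term 1 are injective on truncations; so a compatible pair contributes at
    most [collisions k.+1 hs]. [compat_card] bounds the [z'] compatible with a given [z]. *)
Lemma collisions_step q k w W (c : {ffun 'I_k -> 'I_q}) (hs : seq {poly int}) :
  prime q -> injective c -> (0 < w)%N -> (k * w <= W)%N ->
  (forall h, h \in hs -> h`_0 = 1) ->
  (collisions k.+1 (level_step w W c hs) <=
   (q ^ W.-1) ^ k * ((q ^ w) ^ 'C(k, 2) * (q ^ (W - k * w)) ^ k) * collisions k.+1 hs)%N.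
Proof.
move=> q_pr c_inj w0 kwW hs0.
have p0 : (0 < q ^ w)%N by rewrite expn_gt0 prime_gt0.
pose T : finType := {ffun 'I_k -> 'I_(q ^ W.-1)}.
pose e (z z' : T) h h' := eq_trunc k.+1 (lin_prod (level_var c z) * dilate (q ^ w) h)
  (lin_prod (level_var c z') * dilate (q ^ w) h') : bool.
(* The arguments of [e] are exchanged so that the fixed [z] supplies the polynomial [A] of
   [compat_card]. *)
pose compat (z z' : T) := has (fun h => has (fun h' => e z' z h' h) hs) hs.
have inner (z z' : T) : (\sum_(h <- hs) \sum_(h' <- hs) e z z' h h' <= compat z z' * collisions k.+1 hs)%N.
  case H : (compat z z'); last first.
    rewrite mul0n leqn0 big_seq big1 // => h hin; rewrite big_seq big1 // => h' h'in.
    case E : (e z z' h h') => //; move/negbT/hasPn/(_ h hin)/hasPn: H => /(_ h' h'in).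
    by rewrite /e eq_trunc_sym -/(e _ _ _ _) E.
  rewrite mul1n.
  have := pair_collisions_trunc k.+1 [seq lin_prod (level_var c z) * dilate (q ^ w) h | h <- hs]
     [seq lin_prod (level_var c z') * dilate (q ^ w) h | h <- hs].
  rewrite /collisions !big_map.
  pose g (y : T) h := lin_prod (level_var c y) * dilate (q ^ w) h.
  have E (y : T) : (\sum_(j <- hs) \sum_(b <- [seq g y h | h <- hs])
      eq_trunc k.+1 (g y j) b)%N = collisions k.+1 hs.
    apply: eq_bigr => h _; rewrite big_map; apply: eq_bigr => h' _; congr nat_of_bool.
    apply/idP/idP => [/(eq_trunc_mulI (lin_prod0 _))|]; first by rewrite eq_trunc_dilate.
    by move=> ee; apply: eq_truncM (eq_trunc_refl _ _) _; rewrite eq_trunc_dilate.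
  rewrite !E addnn leq_double; apply: leq_trans.
  by apply: leq_sum => h _; rewrite big_map.
have -> : collisions k.+1 (level_step w W c hs) =
   (\sum_(z : T) \sum_(z' : T) \sum_(h <- hs) \sum_(h' <- hs) e z z' h h')%N.
  rewrite /collisions /level_step big_allpairs_dep big_enum /=; apply: eq_big => // z _.
  rewrite [RHS]exchange_big /=; apply: eq_bigr => h _.
  by rewrite big_allpairs_dep big_enum /=; apply: eq_big.
apply: (@leq_trans (\sum_(z : T) \sum_(z' : T) compat z z' * collisions k.+1 hs)).
  by apply: leq_sum => z _; apply: leq_sum => z' _; apply: inner.
under eq_bigr => z _ do rewrite -big_distrl /=.
rewrite -big_distrl /= leq_mul2r; apply/orP; right.
have -> : ((q ^ W.-1) ^ k = #|T|)%N by rewrite card_ffun !card_ord.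
rewrite -sum_nat_const; apply: leq_sum => z _.
have -> : (\sum_(z' : T) compat z z')%N = #|[set z' | compat z z']|.
  by rewrite -sum1_card [RHS]big_mkcond /=; apply: eq_bigr => z' _; rewrite inE; case: (compat z z').
apply: (compat_card q_pr c_inj w0 kwW (A := lin_prod (level_var c z))) => z'.
rewrite inE => /hasP[h hin] /hasP[h' h'in] E.
by exists h', h; split; rewrite ?hs0.
Qed.

(** The terms in [w] cancel because [2 'C(k, 2) + k = k^2]. This is why a level loses only [q ^ k]
    against the ideal saving [q ^ (w * 'C(k.+1, 2))], whatever its [w]. *)
Lemma level_exponents k w W : (0 < W)%N -> (0 < k)%N -> (k * w <= W)%N ->
  (W.-1 * k + (w * 'C(k, 2) + (W - k * w) * k) + w * ('C(k, 2) + k) =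
   W.-1 * k * 2 + k)%N.
Proof.
case: W => // W _; case: k => // k _ H /=.
have c2 : (2 * 'C(k.+1, 2) = k.+1 * k)%N.
  elim: (k) => [|n IHn] //; rewrite binS bin1 mulnDr IHn; lia.
set c := 'C(k.+1, 2) in c2 *.
have : (w * (2 * c) = w * (k.+1 * k))%N by rewrite c2.
move: (subnK H); set x := (W.+1 - _)%N => Hx.
have : (x * k.+1 + k.+1 * w * k.+1 = W.+1 * k.+1)%N by rewrite -mulnDl Hx.
lia.
Qed.

Lemma collisions_level_polys q k W ws (cs : seq {ffun 'I_k -> 'I_q}) :
  prime q -> (0 < k)%N -> valid_levels k W ws -> size cs = size ws ->
  (forall c, c \in cs -> injective c) ->
  (collisions k.+1 (level_polys W ws cs) * q ^ (sumn ws * 'C(k.+1, 2)) <=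
    size (level_polys W ws cs) ^ 2 * q ^ (k * size ws))%N.
Proof.
move=> q_pr k0; elim: ws W cs => [|w ws IH] W [|c cs] //=.
  by move=> _ _ _; rewrite /collisions !big_seq1 eq_trunc_refl mul0n muln0.
move=> /and3P[w0 kwW V] [sz] cinj.
have W0 : (0 < W)%N by rewrite (leq_trans _ kwW) // muln_gt0 k0 w0.
have cI : injective c by apply: cinj; rewrite mem_head.
have {}IH := IH _ cs V sz (fun x xin => cinj x (mem_behead (s := c :: cs) xin)).
set hs := level_polys (W - w) ws cs in IH *.
have hs0 h : h \in hs -> h`_0 = 1 by exact: level_polys0.
have := collisions_step q_pr cI w0 kwW hs0.
rewrite size_allpairs -cardE card_ffun !card_ord.
set Col := collisions _ _; set Col' := collisions _ _ => H.
have E : ((q ^ W.-1) ^ k * ((q ^ w) ^ 'C(k, 2) * (q ^ (W - k * w)) ^ k) * q ^ (w * 'C(k.+1, 2))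
   = ((q ^ W.-1) ^ k) ^ 2 * q ^ k)%N.
  rewrite -!expnM -!expnD; congr (q ^ _)%N; rewrite binS bin1.
  exact: level_exponents.
rewrite mulnDl expnD mulnS expnD mulnA.
rewrite -mulnA; apply: leq_trans (leq_mul H (leqnn _)) _.
rewrite mulnACA E expnMn [X in (_ <= X)%N]mulnACA leq_mul2l; apply/orP; right.
exact: IH.
Qed.

(** The elementary symmetric function of degree [j] in [m] variables from [[0, U]] is at most
    ['C(m, j) U^j]; the weaker [(m U)^j] is easier to carry through products and dilations. *)
Definition coef_bounded (m U : nat) (f : {poly int}) : Prop :=
  forall j, 0 <= f`_j <= (m * U)%N%:Z ^+ j.

Lemma coef_bounded_lin m U y f : (y <= U)%N -> coef_bounded m U f ->
  coef_bounded m.+1 U (f * (1 + y%:Z%:P * 'X)).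
Proof.
move=> yU Hf [|j].
  by have := Hf 0%N; rewrite !expr0 mulrDr mulr1 coefD mulrA coefMX /= addr0.
rewrite mulrDr mulr1 coefD mulrA coefMX /= coefMC.
have /andP[a0 a1] := Hf j.+1; have /andP[b0 b1] := Hf j.
apply/andP; split; first by rewrite addr_ge0 ?mulr_ge0.
have e1 : f`_j * y%:Z <= (m * U)%N%:Z ^+ j * U%:Z by apply: ler_pM.
apply: le_trans (lerD a1 e1) _.
have -> : (m * U)%N%:Z ^+ j.+1 + (m * U)%N%:Z ^+ j * U%:Z =
    (m * U)%N%:Z ^+ j * (m.+1 * U)%N%:Z by rewrite exprSr -mulrDr mulSn addnC PoszD.
rewrite [X in _ <= X]exprSr ler_wpM2r //.
by rewrite lerXn2r ?nnegrE // lez_nat leq_mul2r leqnSn orbT.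
Qed.

Lemma coef_bounded_lin_prod m U k (y : 'I_k -> nat) f :
  (forall i, (y i <= U)%N) -> coef_bounded m U f ->
  coef_bounded (m + k) U (f * lin_prod (fun i => (y i)%:Z)).
Proof.
elim: k y => [|k IH] y Hy Hf; first by rewrite /lin_prod big_ord0 mulr1 addn0.
rewrite /lin_prod big_ord_recr /= mulrA addnS; apply: coef_bounded_lin => //.
exact: (IH (fun i => y (widen_ord (leqnSn k) i))).
Qed.

Lemma coef_bounded_dilate m U p f : coef_bounded m U f -> coef_bounded m (p * U) (dilate p f).
Proof.
move=> Hf j; rewrite coef_dilate; have /andP[a0 a1] := Hf j.
rewrite mulr_ge0 ?exprn_ge0 //= mulnCA PoszM exprMn mulrC.
by rewrite ler_wpM2l ?exprn_ge0.
Qed.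

Lemma level_polys_bounded q k W ws (cs : seq {ffun 'I_k -> 'I_q}) h :
  (0 < q)%N -> (0 < k)%N -> valid_levels k W ws -> h \in level_polys W ws cs ->
  coef_bounded (k * size ws) (q ^ W) h.
Proof.
move=> q0 k0; elim: ws W cs h => [|w ws IH] W [|c cs] h /=.
- by move=> _; rewrite inE => /eqP -> [|j]; rewrite coef1 ?expr0 ?exprn_ge0.
- by move=> _; rewrite inE => /eqP -> [|j]; rewrite coef1 ?expr0 ?exprn_ge0.
- by move=> _; rewrite inE => /eqP -> [|j]; rewrite coef1 ?expr0 ?exprn_ge0.
move=> /and3P[w0 kwW V] /allpairsP[[z g] /= [_ gin ->]].
have wW : (w <= W)%N by rewrite (leq_trans _ kwW) // leq_pmull.
have W0 : (0 < W)%N by rewrite (leq_trans w0).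
rewrite mulrC mulnS addnC.
apply: (@coef_bounded_lin_prod _ _ _ (fun i => c i + q * z i)%N) => [i|].
  have cq := ltn_ord (c i); have zq := ltn_ord (z i).
  have -> : (q ^ W = q * q ^ W.-1)%N by rewrite -expnS prednK.
  apply: (@leq_trans (q + q * z i)); first by rewrite leq_add2r ltnW.
  by rewrite -mulnS leq_mul2l zq orbT.
by rewrite -(subnKC wW) expnD; apply/coef_bounded_dilate/(IH _ cs).
Qed.

(** Every level takes the largest admissible step [w = W %/ k]. While [W >= 2^t k] such a step
    removes at least [2^t], so about [k] steps halve [W]; [m] bounds the steps left in the current
    dyadic range. *)
Lemma valid_levels_exist k t m W : (1 < k)%N -> (0 < W)%N -> (W < 2 ^ t * (k + m))%N ->
  exists ws, [/\ valid_levels k W ws, (size ws <= k * t + m)%N, (W - sumn ws < k)%N &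
     (sumn ws < W)%N].
Proof.
move=> k1; elim: t m W => [|t IHt] m W W0.
  rewrite muln0 add0n; elim: m W W0 => [|m IHm] W W0 HW.
    by exists [::]; split; rewrite //= ?subn0 //; lia.
  have [H|H] := ltnP W (2 ^ 0 * (k + m)).
    by have [ws [? ? ? ?]] := IHm W W0 H; exists ws; split => //; lia.
  have Wk : (k <= W)%N by lia.
  have d0 : (0 < W %/ k)%N by rewrite divn_gt0; lia.
  have d1 : (W %/ k < W)%N by rewrite ltn_Pdiv.
  have W'0 : (0 < W - W %/ k)%N by rewrite subn_gt0.
  have [|ws [V s e l]] := IHm (W - W %/ k)%N W'0; first lia.
  exists (W %/ k :: ws)%N; split => /=; try lia.
elim: m W W0 => [|m IHm] W W0 HW.
  have [|ws [V s e l]] := IHt k W W0; first by rewrite expnS in HW; lia.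
  by exists ws; split => //; rewrite mulnS; lia.
have [H|H] := ltnP W (2 ^ t.+1 * (k + m)).
  by have [ws [? ? ? ?]] := IHm W W0 H; exists ws; split => //; lia.
have d2 : (2 ^ t.+1 <= W %/ k)%N.
  by rewrite leq_divRL; [rewrite (leq_trans _ H) // leq_mul2l leq_addr orbT|lia].
have t0 : (0 < 2 ^ t.+1)%N by rewrite expn_gt0.
have d1 : (W %/ k < W)%N by rewrite ltn_Pdiv.
have W'0 : (0 < W - W %/ k)%N by rewrite subn_gt0.
have [|ws [V s e l]] := IHm (W - W %/ k)%N W'0.
  rewrite addnS mulnS in HW; lia.
exists (W %/ k :: ws)%N; split => /=; try lia.
Qed.

(** * Orthogonality and the large sieve *)

Lemma coprimez_inv (Q : nat) (x : int) :
  coprimez x Q -> exists y, (Q %| x * y - 1)%Z.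
Proof.
move=> /coprimezP[[u v] /= E]; exists u.
by rewrite (_ : x * u - 1 = - v * Q%:Z); [rewrite dvdz_mull|rewrite -E; ring].
Qed.

Lemma coprimez_1D (Q K : nat) (d u : int) :
  (Q %| d ^+ K)%Z -> coprimez (1 + d * u) Q.
Proof.
move=> Qd; apply: (@coprime_dvdr _ `|d ^+ K|%N); first by rewrite -dvdzE.
rewrite -coprimezE.
apply: coprimezXr; apply/coprimezP; exists (1, - u) => /=; ring.
Qed.

Section CharacterOrthogonality.

Variables (C : numClosedFieldType) (Q : nat) (chi : int -> C).
Hypothesis Q_gt0 : (0 < Q)%N.
Hypothesis chi_per : forall m n : int, (Q %| m - n)%Z -> chi m = chi n.
Hypothesis chiM : forall m n : int, chi (m * n) = chi m * chi n.
Hypothesis chi_eq0 : forall n : int, (chi n == 0) = ~~ coprimez n Q.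
Hypothesis chi_prim : forall g : nat, (g %| Q)%N ->
  (forall m n : int, (g %| m - n)%Z -> chi m = chi n) ->
  (forall n : int, (chi n == 0) = ~~ coprimez n g) -> g = Q.

Lemma char1 : chi 1 = 1.
Proof.
have : chi 1 * chi 1 = chi 1 * 1 by rewrite -chiM !mulr1.
by apply: mulfI; rewrite chi_eq0 negbK coprimezE /= coprime1n.
Qed.

Lemma charX n j : chi (n ^+ j) = chi n ^+ j.
Proof. by elim: j => [|j IH]; rewrite ?expr0 ?char1 // !exprS chiM IH. Qed.

Lemma char_norm1 n : coprimez n Q -> `|chi n| = 1.
Proof.
move=> cop; have [m mE] : exists m : nat, (Q %| n - m%:Z)%Z.
  exists `|(n %% Q)%Z|%N; rewrite gez0_abs ?modz_ge0 //; last by lia.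
  by rewrite -eqz_mod_dvd modz_mod.
have cop' : coprime m Q.
  have : coprimez m Q.
    have := chi_eq0 n; rewrite (chi_per mE) chi_eq0 cop /=.
    by move=> /negbFE.
  by [].
have E : chi (m%:Z ^+ totient Q) = 1.
  rewrite -char1; apply: chi_per.
  rewrite -eqz_mod_dvd -[_ ^+ _](_ : (m ^ totient Q)%N%:Z = _); last by rewrite -!natz natrX.
  by rewrite -[X in _ == (X %% _)%Z]/(1%N%:Z) !modz_nat Euler_exp_totient.
have /eqP : `|chi n| ^+ totient Q = 1 by rewrite (chi_per mE) -normrX -charX E normr1.
by rewrite pexpr_eq1 ?totient_gt0 // => /eqP.
Qed.

Lemma char_norm_le1 n : `|chi n| <= 1.
Proof.
have [/char_norm1 -> //|H] := boolP (coprimez n Q).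
by rewrite (_ : chi n = 0) ?normr0 ?ler01 //; apply/eqP; rewrite chi_eq0.
Qed.

Lemma char_conjK n : coprimez n Q -> chi n * (chi n)^* = 1.
Proof. by move=> /char_norm1 E; rewrite -normCK E expr1n. Qed.

Lemma char_linear (m s t : int) : (Q %| m * m)%Z ->
  chi (1 + (s + t) * m) = chi (1 + s * m) * chi (1 + t * m).
Proof.
move=> Qm; rewrite -chiM; apply: chi_per.
rewrite (_ : _ - _ = m * m * (- (s * t))); last by ring.
exact: dvdz_mulr.
Qed.

Lemma char_linearX (m : int) (t : nat) : (Q %| m * m)%Z ->
  chi (1 + t%:Z * m) = chi (1 + m) ^+ t.
Proof.
move=> Qm; elim: t => [|t IH]; first by rewrite mul0r addr0 char1.
by rewrite -addn1 PoszD char_linear // IH mul1r exprD expr1.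
Qed.

(** By linearity [chi] is 1 at all [1 + t m], so on residues prime to [Q] it has period
    [g = gcd (m, Q)]. As [Q] divides [m^2], the primes of [Q] all divide [g]; the zeros agree as
    well, and primitivity gives [g = Q]. *)
Lemma char_prim_trivial (m : int) :
  (Q %| m * m)%Z -> chi (1 + m) = 1 -> (Q %| m)%Z.
Proof.
move=> Qm E1; pose g := gcdn `|m| Q.
suff gQ : g = Q by rewrite -gQ dvdzE /= dvdn_gcdl.
have Et (t : int) : chi (1 + t * m) = 1.
  have -> : chi (1 + t * m) = chi (1 + `|(t %% Q)%Z|%N%:Z * m).
    apply: chi_per; rewrite gez0_abs ?modz_ge0 //; last by lia.
    rewrite (_ : _ - _ = (t - (t %% Q)%Z) * m); last by ring.
    by rewrite dvdz_mulr // -eqz_mod_dvd modz_mod.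
  by rewrite char_linearX // E1 expr1n.
have gc (n : int) : coprimez n g = coprimez n Q.
  rewrite !coprimezE; apply/idP/idP => [ng|]; last first.
    by apply: coprime_dvdr; rewrite /= dvdn_gcdr.
  set c := gcdn `|n| Q.
  have cm : coprime c `|m|.
    rewrite /coprime -dvdn1 -(eqP ng) dvdn_gcd; apply/andP; split.
      by rewrite (dvdn_trans (dvdn_gcdl _ _)) // dvdn_gcdl.
    by rewrite /g dvdn_gcd dvdn_gcdr (dvdn_trans (dvdn_gcdl _ _)) // dvdn_gcdr.
  have : (c %| `|m| * `|m|)%N.
    by rewrite -abszM (dvdn_trans (dvdn_gcdr _ _)).
  by rewrite (Gauss_dvdl _ cm) => H; rewrite /coprime -dvdn1 -(eqP cm) dvdn_gcd dvdnn.
apply: chi_prim; first by rewrite dvdn_gcdr.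
  move=> x y; have [xQ|nxQ] := boolP (coprimez x Q); last first.
    move=> xy; have nyQ : ~~ coprimez y Q.
      rewrite -!gc in nxQ *; apply: contra nxQ => /coprimezP[[u v] /= E].
      have /dvdzP[w wE] := xy.
      apply/coprimezP; exists (u, v - u * w) => /=.
      have -> : x = y + w * g by rewrite -wE; ring.
      rewrite -E; ring.
    by transitivity (0 : C); [|symmetry]; apply/eqP; rewrite chi_eq0.
  move=> /dvdzP[v vE].
  have [xb xbE] := coprimez_inv xQ.
  have [u [w gE]] : exists u w, g%:Z = u * m + w * Q%:Z.
    by have [u [w E]] := Bezoutz m Q; exists u, w; rewrite E.
  transitivity (chi (x * (1 + (- v * u * xb) * m))); first by rewrite chiM Et mulr1.
  apply: chi_per.
  have -> : y = x - v * g by rewrite -vE; ring.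
  have /dvdzP[r rE] := xbE.
  rewrite gE (_ : _ - _ = (v * w - v * u * m * r) * Q%:Z); first exact: dvdz_mull.
  transitivity (v * w * Q%:Z - v * u * m * (x * xb - 1)); first ring.
  by rewrite rE; ring.
by move=> n; rewrite chi_eq0 gc.
Qed.

(* The terms form a geometric progression because [Q %| d ^+ j * d ^+ j]; if its ratio
   were 1, primitivity would give [D %| nb ^+ j - nb' ^+ j]. *)
Lemma sum_char_shift (d nb nb' a a' : int) (j K L D : nat) :
  (0 < j)%N -> (Q %| d ^+ K)%Z -> (Q %| d ^+ j * d ^+ j)%Z -> (Q %| d ^+ j * L%:Z)%Z ->
  (D %| d)%Z -> (D %| Q)%N -> (forall e, (Q %| d ^+ j * e)%Z -> (D %| e)%Z) ->
  (d %| a - 1)%Z -> (d %| a' - 1)%Z -> ~~ (D %| nb ^+ j - nb' ^+ j)%Z ->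
  \sum_(t < L) chi (a + t%:Z * (d * nb) ^+ j) * (chi (a' + t%:Z * (d * nb') ^+ j))^* = 0.
Proof.
move=> j0 QK Q2 QL Dd DQ HD da da' nD.
have unit1 x : (d %| x - 1)%Z -> coprimez x Q.
  move=> /dvdzP[u uE]; rewrite (_ : x = 1 + d * u); first exact: coprimez_1D QK.
  by rewrite mulrC -uE; ring.
have cu s : coprimez (1 + s * d ^+ j) Q.
  by rewrite -(prednK j0) exprS mulrCA; apply: coprimez_1D QK.
have [ab abE] := coprimez_inv (unit1 _ da); have [ab' abE'] := coprimez_inv (unit1 _ da').
have split x xb n t : (Q %| x * xb - 1)%Z ->
    chi (x + t * (d * n) ^+ j) = chi x * chi (1 + (t * (n ^+ j * xb)) * d ^+ j).
  move=> xE; rewrite -chiM; apply: chi_per.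
  rewrite (_ : _ - _ = (x * xb - 1) * (- (t * n ^+ j * d ^+ j))); last by rewrite exprMn; ring.
  exact: dvdz_mulr.
have QM s t : (Q %| (s * d ^+ j) * (t * d ^+ j))%Z.
  by rewrite mulrACA dvdz_mull.
pose e := nb ^+ j * ab - nb' ^+ j * ab'.
pose w := chi (1 + e * d ^+ j).
have term (t : 'I_L) : chi (a + t%:Z * (d * nb) ^+ j) * (chi (a' + t%:Z * (d * nb') ^+ j))^*
    = chi a * (chi a')^* * w ^+ t.
  rewrite (split _ _ _ _ abE) (split _ _ _ _ abE') rmorphM /=.
  rewrite (_ : t%:Z * (nb ^+ j * ab) = t%:Z * (nb' ^+ j * ab') + t%:Z * e); last by rewrite /e; ring.
  rewrite char_linear // /w -char_linearX //.
  rewrite (_ : t%:Z * e * d ^+ j = t%:Z * (e * d ^+ j)); last by rewrite mulrA.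
  have BB := char_conjK (cu (t%:Z * (nb' ^+ j * ab'))).
  set B := chi (1 + _) in BB *; set W := chi (1 + _).
  transitivity (chi a * (chi a')^* * W * (B * B^*)); last by rewrite BB mulr1.
  ring.
under eq_bigr => t _ do rewrite term.
rewrite -mulr_sumr.
have wL : w ^+ L = 1.
  rewrite /w -char_linearX // -char1; apply: chi_per.
  rewrite (_ : _ - _ = d ^+ j * L%:Z * e); [exact: dvdz_mulr|ring].
have w1 : w != 1.
  apply/negP => /eqP w1; move/negP: nD; apply.
  have /HD De : (Q %| d ^+ j * e)%Z by rewrite mulrC; apply: char_prim_trivial.
  have inv1 x xb : (d %| x - 1)%Z -> (Q %| x * xb - 1)%Z -> (D %| xb - 1)%Z.
    move=> dx Qx; rewrite (_ : xb - 1 = (x * xb - 1) - (x - 1) * xb); last by ring.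
    by rewrite rpredB ?dvdz_mulr // ?(dvdz_trans _ Qx) // (dvdz_trans Dd).
  have D1 := inv1 _ _ da abE; have D2 := inv1 _ _ da' abE'.
  rewrite (_ : _ - _ = e - nb ^+ j * (ab - 1) + nb' ^+ j * (ab' - 1)); last by rewrite /e; ring.
  by apply: rpredD; [apply: rpredB; [exact: De|exact: dvdz_mull]|exact: dvdz_mull].
have : (w - 1) * (\sum_(i < L) w ^+ i) = 0 by rewrite -subrX1 wL subrr.
by move=> /eqP; rewrite mulf_eq0 subr_eq0 (negPf w1) => /eqP ->; rewrite mulr0.
Qed.

End CharacterOrthogonality.

(** The row sums of the Gram matrix [K] bound its norm by Schur's test, and a matrix and its adjoint
    have the same norm. *)
Lemma dual_large_sieve (C : numClosedFieldType) (T I : finType) (B : {pred T})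
    (phi : I -> T -> C) (N : T -> C) (M : C) :
  0 < M ->
  (forall i, \sum_i' `|\sum_(s in B) phi i s * (phi i' s)^*| <= M) ->
  \sum_i `|\sum_(s in B) N s * phi i s| ^+ 2 <= M * \sum_(s in B) `|N s| ^+ 2.
Proof.
move=> M0 HM.
pose K i i' := \sum_(s in B) phi i s * (phi i' s)^*.
have KC i i' : `|K i i'| = `|K i' i|.
  rewrite -norm_conjC rmorph_sum /=; congr `|_|; apply: eq_bigr => s _.
  by rewrite rmorphM /= conjCK mulrC.
pose z i := \sum_(s in B) N s * phi i s.
pose w s := \sum_i (z i)^* * phi i s.
rewrite -/(z _).
set Z := \sum_i _; set S := \sum_(s in B) _.
have ZE : Z = \sum_i z i * (z i)^* by apply: eq_bigr => i _; rewrite normCK.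
have Nw : \sum_(s in B) N s * w s = Z.
  under eq_bigr => s _ do rewrite mulr_sumr.
  rewrite exchange_big /= ZE; apply: eq_bigr => i _.
  rewrite mulrC /z mulr_sumr; apply: eq_bigr => s _; ring.
have w2 : \sum_(s in B) `|w s| ^+ 2 <= M * Z.
  set S2' := \sum_(s in B) _; pose S2 := \sum_i \sum_i' (z i)^* * z i' * K i i'.
  have S2_ge0 : 0 <= S2 -> S2 <= \sum_i \sum_i' (`|z i| ^+ 2 + `|z i'| ^+ 2) / 2 * `|K i i'|.
    move=> /ger0_norm <-; apply: le_trans (ler_norm_sum _ _ _) _; apply: ler_sum => i _.
    apply: le_trans (ler_norm_sum _ _ _) _; apply: ler_sum => i' _.
    rewrite !normrM norm_conjC ler_wpM2r //.
    have : 0 <= (`|z i| - `|z i'|) ^+ 2 by rewrite -realEsqr rpredB // normr_real.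
    move=> H; rewrite ler_pdivlMr // -subr_ge0.
    by rewrite (_ : _ - _ = (`|z i| - `|z i'|) ^+ 2) //; ring.
  have e1 : \sum_i \sum_i' `|z i| ^+ 2 * `|K i i'| <= M * Z.
    rewrite mulr_sumr; apply: ler_sum => i _; rewrite -mulr_sumr mulrC.
    by apply: ler_wpM2r; [rewrite exprn_ge0|exact: HM].
  have e2 : \sum_i \sum_i' `|z i'| ^+ 2 * `|K i i'| = \sum_i \sum_i' `|z i| ^+ 2 * `|K i i'|.
    rewrite exchange_big /=; apply: eq_bigr => i _; apply: eq_bigr => i' _.
    by rewrite KC.
  have S2E : S2 = S2'.
    have ws s : `|w s| ^+ 2 = \sum_i \sum_i' (z i)^* * z i' * (phi i s * (phi i' s)^*).
      rewrite normCK /w rmorph_sum /= mulr_suml; apply: eq_bigr => i _.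
      rewrite mulr_sumr; apply: eq_bigr => i' _.
      by rewrite rmorphM /= conjCK; ring.
    rewrite /S2'; under [RHS]eq_bigr => s _ do rewrite ws.
    rewrite /S2 [RHS]exchange_big /=; apply: eq_bigr => i _.
    rewrite [RHS]exchange_big /=; apply: eq_bigr => i' _.
    by rewrite mulr_sumr.
  rewrite -S2E; apply: le_trans (S2_ge0 _) _.
    by rewrite S2E; apply: sumr_ge0 => s _; rewrite exprn_ge0.
  apply: le_trans e1; rewrite le_eqVlt; apply/orP; left; apply/eqP.
  set X := \sum_i \sum_i' `|z i| ^+ 2 * `|K i i'| in e2 *.
  transitivity ((X + \sum_i \sum_i' `|z i'| ^+ 2 * `|K i i'|) / 2); last first.
    by rewrite e2 -mulr2n -[X *+ 2]mulr_natr mulfK // pnatr_eq0.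
  rewrite /X -big_split /= mulr_suml; apply: eq_bigr => i _.
  rewrite -big_split /= mulr_suml; apply: eq_bigr => i' _.
  ring.
(* Duality by completing a square: the sum expands to [sum |w|^2 - 2 M Z + M^2 S], and [w2] bounds
   its first term by [M Z]. *)
have : 0 <= \sum_(s in B) `|w s - M * (N s)^*| ^+ 2 by apply: sumr_ge0 => s _; rewrite exprn_ge0.
have Mr : M^* = M by apply/CrealP; rewrite realE ltW.
have Zr : Z^* = Z by rewrite ZE rmorph_sum; apply: eq_bigr => i _; rewrite rmorphM /= conjCK mulrC.
have -> : \sum_(s in B) `|w s - M * (N s)^*| ^+ 2 =
    \sum_(s in B) `|w s| ^+ 2 - M * (\sum_(s in B) N s * w s) - M * (\sum_(s in B) N s * w s)^*
     + M ^+ 2 * S.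
  rewrite rmorph_sum /= !mulr_sumr -!sumrB -big_split /=; apply: eq_bigr => s _.
  by rewrite !normCK !(rmorphB, rmorphM) /= conjCK Mr; ring.
rewrite Nw Zr => H.
have {}H : M * Z <= M * (M * S).
  rewrite -subr_ge0; apply: le_trans H _; rewrite -subr_ge0.
  rewrite (_ : _ - _ = M * Z - \sum_(s in B) `|w s| ^+ 2) ?subr_ge0 //; ring.
by rewrite ler_pM2l in H.
Qed.

Definition box (k M : nat) (L : 'I_k -> nat) : {pred {ffun 'I_k -> 'I_M}} :=
  [pred f : {ffun 'I_k -> 'I_M} | [forall j, (f j < L j)%N]].

Arguments box {k} M L.

Definition update (k M : nat) (f : {ffun 'I_k -> 'I_M}) (j : 'I_k) (t : 'I_M) :
    {ffun 'I_k -> 'I_M} := [ffun i => if i == j then t else f i].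

(** The box is cut into lines in direction [j], each represented by its point with [j]-th coordinate
    0. *)
Lemma sum_box_eq0 (V : zmodType) k M (L : 'I_k -> nat) (j : 'I_k)
    (F : {ffun 'I_k -> 'I_M.+1} -> V) :
  (0 < L j <= M.+1)%N ->
  (forall f, f \in box M.+1 L -> nat_of_ord (f j) = 0%N ->
     \sum_(t < M.+1 | (t < L j)%N) F (update f j t) = 0) ->
  \sum_(f in box M.+1 L) F f = 0.
Proof.
move=> /andP[L0 LM] H.
rewrite (partition_big (fun f => update f j ord0)
   (fun f => (f \in box M.+1 L) && (f j == ord0))) /=; last first.
  move=> f /forallP fL; apply/andP; split; last by rewrite ffunE eqxx.
  by apply/forallP => i; rewrite ffunE; case: eqP => // ->.
rewrite big1 // => g /andP[gL /eqP g0]; rewrite -[RHS](H g gL); last by rewrite g0.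
rewrite (reindex_onto (fun t => update g j t) (fun f : {ffun _} => f j)) /=.
  apply: eq_bigl => t; rewrite !inE !ffunE eqxx.
  have -> : (update (update g j t) j ord0 == g).
    by apply/eqP/ffunP => i; rewrite !ffunE; case: eqP => // ->; rewrite g0.
  rewrite eqxx !andbT; apply/forallP/idP => [/(_ j)|tL i]; rewrite ffunE ?eqxx //.
  by case: eqP => [->//|_]; move/forallP: gL; apply.
move=> f /andP[_ /eqP <-]; apply/ffunP => i; rewrite !ffunE.
by case: eqP => // ->.
Qed.

Lemma horner_trunc (K : nat) (h : {poly int}) (z : int) (Q : nat) :
  (Q %| z ^+ K)%Z -> (Q %| h.[z] - (take_poly K h).[z])%Z.
Proof.
move=> Qz; rewrite -{1}(poly_take_drop K h) hornerD hornerM hornerXn addrAC subrr add0r.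
exact: dvdz_mull.
Qed.

Lemma card_residue (x D : nat) (i : 'I_x) :
  (0 < D)%N -> (#|[set i' : 'I_x | (D %| (i%:Z - i'%:Z)%R)%Z]| <= x %/ D + 1)%N.
Proof.
move=> D0.
have Hlt (i' : 'I_x) : (i' %/ D < (x %/ D).+1)%N by rewrite ltnS leq_div2r // ltnW.
rewrite addn1 -[X in (_ <= X)%N]card_ord.
rewrite -(card_in_imset (f := fun i' : 'I_x => Ordinal (Hlt i'))).
  exact: max_card.
move=> a b; rewrite !inE -!eqz_mod_dvd => /eqP Ha /eqP Hb [E].
apply: val_inj => /=.
have {}Ha : (i = a %[mod D])%N.
  by move: Ha; rewrite !modz_nat => -[].
have {}Hb : (i = b %[mod D])%N.
  by move: Hb; rewrite !modz_nat => -[].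
by rewrite (divn_eq a D) (divn_eq b D) E -Ha -Hb.
Qed.

(** A single power can agree for different residues; the quotient of two consecutive powers recovers
    [nb] modulo [D], hence [n]. *)
Lemma inv_mod_eq (D : nat) (n n' nb nb' : int) (j : nat) :
  (D %| n * nb - 1)%Z -> (D %| n' * nb' - 1)%Z ->
  (D %| nb ^+ j - nb' ^+ j)%Z -> (D %| nb ^+ j.+1 - nb' ^+ j.+1)%Z ->
  (D %| n - n')%Z.
Proof.
move=> H1 H2 Hj Hj1.
have cop : coprimez D (nb ^+ j).
  apply: coprimezXr; have /dvdzP[r rE] := H1.
  by apply/coprimezP; exists (- r, n) => /=; rewrite mulNr -rE; ring.
have : (D %| nb ^+ j * (nb - nb'))%Z.
  rewrite (_ : _ * _ = (nb ^+ j.+1 - nb' ^+ j.+1) - nb' * (nb ^+ j - nb' ^+ j)).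
    by rewrite rpredB // dvdz_mull.
  by rewrite !exprS; ring.
rewrite Gauss_dvdzr // => H.
rewrite (_ : n - n' = n' * (n * nb - 1) - n * (n' * nb' - 1) - n * n' * (nb - nb')); last by ring.
by rewrite !rpredB // dvdz_mull.
Qed.

Section LargeSieve.

Variables (C : numClosedFieldType) (Q : nat) (chi : int -> C).
Hypothesis Q_gt0 : (0 < Q)%N.
Hypothesis chi_per : forall m n : int, (Q %| m - n)%Z -> chi m = chi n.
Hypothesis chiM : forall m n : int, chi (m * n) = chi m * chi n.
Hypothesis chi_eq0 : forall n : int, (chi n == 0) = ~~ coprimez n Q.
Hypothesis chi_prim : forall g : nat, (g %| Q)%N ->
  (forall m n : int, (g %| m - n)%Z -> chi m = chi n) ->
  (forall n : int, (chi n == 0) = ~~ coprimez n g) -> g = Q.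

(* The coordinate [j : 'I_k] of the box stands for the coefficient of ['X^j.+1]. *)
Lemma char_large_sieve (k x D d : nat) (L : 'I_k -> nat) (j1 j2 : 'I_k)
    (v vb : 'I_x -> int) (m : int) (hs : seq {poly int}) :
  (0 < D)%N -> (D %| d)%N -> (D %| Q)%N -> (Q %| d ^ k.+1)%N ->
  (j1.+1 = j2)%N -> (k < j1.+1.*2)%N ->
  (forall j, 0 < L j)%N ->
  (forall j, j \in [:: j1; j2] -> (Q %| d ^ j.+1 * L j)%N /\
     forall e, (Q %| d%:Z ^+ j.+1 * e)%Z -> (D %| e)%Z) ->
  (forall i, v i = m + i%:Z) ->
  (forall i, coprimez (v i) Q -> (Q %| v i * vb i - 1)%Z) ->
  (forall h, h \in hs -> h`_0 = 1 /\ forall j : 'I_k, 0 <= h`_j.+1 < L j) ->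
  \sum_(i < x | coprimez (v i) Q) `|\sum_(h <- hs) chi h.[d%:Z * vb i]| ^+ 2 <=
    ((\prod_j L j) * (x %/ D + 1) * collisions k.+1 hs)%N%:R.
Proof.
move=> D0 Dd DQ Qd j12 kj L0 HL vE vbE Hhs.
pose M := \max_j L j.
have LM j : (L j <= M.+1)%N by rewrite (leq_trans (leq_bigmax j)).
pose T : finType := {ffun 'I_k -> 'I_M.+1}.
pose B : {pred T} := box M.+1 L.
pose P (i : 'I_x) := coprimez (v i) Q.
pose ev (s : T) (z : int) : int := 1 + \sum_j (s j)%:Z * z ^+ j.+1.
(* The value of [chi] as a function of the coefficient vector, higher coefficients being invisible
   because [Q] divides [d ^ k.+1]. Indices not prime to [Q] get the zero function, so they do not
   enter the Gram matrix. *)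
pose phi (i : 'I_x) (s : T) : C := if P i then chi (ev s (d%:Z * vb i)) else 0.
pose code (h : {poly int}) : T := [ffun j : 'I_k => inord (absz h`_j.+1)].
pose N (s : T) : nat := count (fun h => code h == s) hs.
have codeE h j : h \in hs -> (code h j)%:Z = h`_j.+1.
  move=> /Hhs[_ /(_ j)/andP[h0 hL]]; rewrite ffunE inordK ?gez0_abs //.
  by have := LM j; lia.
have codeB h : h \in hs -> code h \in B.
  move=> hin; apply/forallP => j; rewrite -ltz_nat (codeE h j hin).
  by have [_ /(_ j)/andP[]] := Hhs _ hin.
have QdZ n : (k < n)%N -> (Q %| d%:Z ^+ n)%Z.
  move=> kn; rewrite -(subnKC kn) exprD dvdz_mulr //.
  by rewrite -PoszX dvdzE.
have evE h i : h \in hs -> P i -> chi h.[d%:Z * vb i] = phi i (code h).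
  move=> hin Pi; rewrite /phi Pi; apply: chi_per.
  rewrite (_ : ev _ _ = (take_poly k.+1 h).[d%:Z * vb i]).
    apply: horner_trunc; rewrite exprMn dvdz_mulr // QdZ //.
  rewrite (horner_coef_wide _ (size_take_poly _ _)) big_ord_recl /=.
  rewrite coef_take_poly /= (Hhs h hin).1 expr0 mulr1 /ev; congr (_ + _).
  apply: eq_bigr => j _; rewrite codeE // coef_take_poly /= /bump /= add1n ltnS.
  by rewrite ltn_ord.
have sumN (F : T -> C) : \sum_(h <- hs) F (code h) = \sum_(s in B) (N s)%:R * F s.
  transitivity (\sum_(h <- hs) \sum_(s in B) (code h == s)%:R * F s).
    rewrite !big_seq; apply: eq_bigr => h hin.
    rewrite (bigD1 (code h)) ?codeB //= eqxx mul1r big1 ?addr0 // => s /andP[_ sn].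
    by rewrite eq_sym (negPf sn) mul0r.
  rewrite exchange_big /=; apply: eq_bigr => s _; rewrite -mulr_suml; congr (_ * _).
  by rewrite /N -sum1_count natr_sum [RHS]big_mkcond /=; apply: eq_bigr => h _; case: eqP.
have colE : \sum_(s in B) `|(N s)%:R : C| ^+ 2 = (collisions k.+1 hs)%:R.
  rewrite (eq_bigr (fun s => (N s)%:R * (N s)%:R)) => [|s _]; last by rewrite normr_nat.
  rewrite -(sumN (fun s => (N s)%:R)) /collisions natr_sum !big_seq; apply: eq_bigr => a ain.
  rewrite /N -sum1_count !natr_sum [LHS]big_mkcond /= !big_seq; apply: eq_bigr => b bin.
  have -> : eq_trunc k.+1 a b = (code b == code a).
    apply/eq_truncP/eqP => [E|/ffunP E [_|j jk]].
    - by apply/ffunP => j; apply/val_inj/eqP; rewrite -eqz_nat !codeE // E ?ltnS.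
    - by rewrite (Hhs _ ain).1 (Hhs _ bin).1.
    - by have := E (Ordinal (jk : (j < k)%N)) => /(congr1 (fun o : 'I_M.+1 => o%:Z)); rewrite !codeE //= => ->.
  by case: eqP.
pose V := \prod_j L j.
have V0 : (0 < V)%N by rewrite prodn_gt0.
have phi1 i s : `|phi i s| <= 1.
  by rewrite /phi; case: ifP => _; rewrite ?normr0 ?ler01 // (char_norm_le1 Q_gt0 chi_per).
have cardB : (#|B| <= V)%N.
  apply: leq_trans (card_box M.+1 L); apply: subset_leq_card.
  by apply/fintype.subsetP => s; rewrite !inE.
pose K i i' := \sum_(s in B) phi i s * (phi i' s)^*.
(* If one of the two power congruences modulo [D] fails, summation over that single coordinate
   already annihilates the kernel. *)
have K0 i i' : K i i' != 0 -> (D %| i%:Z - i'%:Z)%Z.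
  move=> Kn0; have Pi : P i.
    apply: contraNT Kn0 => nP; rewrite /K big1 // => s _.
    by rewrite /phi (negPf nP) mul0r.
  have Pi' : P i'.
    apply: contraNT Kn0 => nP; rewrite /K big1 // => s _.
    by rewrite /phi (negPf nP) conjC0 mulr0.
  have Hj j : j \in [:: j1; j2] -> (D %| vb i ^+ j.+1 - vb i' ^+ j.+1)%Z.
    move=> jin; apply: contraNT Kn0 => nD; have [QL HD] := HL j jin.
    have j1j : (j1 <= j)%N by move: jin; rewrite !inE => /orP[] /eqP -> //; rewrite -j12.
    apply/eqP; rewrite /K; apply: (@sum_box_eq0 _ _ _ L j); first by rewrite L0 LM.
    move=> f fB fj0.
    pose a z : int := 1 + \sum_(l | l != j) (f l)%:Z * z ^+ l.+1.
    have evU t z : ev (update f j t) z = a z + t%:Z * z ^+ j.+1.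
      rewrite /ev (bigD1 j) //= ffunE eqxx addrCA [RHS]addrC; congr (_ + (_ + _)).
      by apply: eq_bigr => l /negPf lj; rewrite ffunE lj.
    have da y : (d %| a (d%:Z * y) - 1)%Z.
      rewrite /a addrC addKr; apply: rpred_sum => l _.
      by rewrite dvdz_mull // exprS -mulrA dvdz_mulr.
    rewrite (eq_bigr (fun t : 'I_M.+1 => chi (a (d%:Z * vb i) + t%:Z * (d%:Z * vb i) ^+ j.+1)
      * (chi (a (d%:Z * vb i') + t%:Z * (d%:Z * vb i') ^+ j.+1))^*)) => [|t _]; last first.
      by rewrite /phi Pi Pi' !evU.
    rewrite -(big_ord_widen _ (fun t => chi (a (d%:Z * vb i) + t%:Z * (d%:Z * vb i) ^+ j.+1)
      * (chi (a (d%:Z * vb i') + t%:Z * (d%:Z * vb i') ^+ j.+1))^*)) //.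
    apply: (sum_char_shift Q_gt0 chi_per chiM chi_eq0 chi_prim (K := k.+1) (D := D)) => //.
    - exact: QdZ.
    - by rewrite -exprD QdZ // addnn (leq_trans kj) // leq_double.
    - by rewrite -PoszX -PoszM dvdzE.
  have unitD i0 : P i0 -> (D %| v i0 * vb i0 - 1)%Z.
    by move=> /vbE; apply: dvdz_trans; rewrite dvdzE.
  rewrite (_ : i%:Z - i'%:Z = v i - v i'); last by rewrite !vE; ring.
  apply: (inv_mod_eq (j := j1.+1) (unitD _ Pi) (unitD _ Pi')).
    by apply: Hj; rewrite mem_head.
  by rewrite j12; apply: Hj; rewrite !inE eqxx orbT.
have Kle i i' : `|K i i'| <= V%:R.
  apply: le_trans (ler_norm_sum _ _ _) _.
  apply: (@le_trans _ _ (\sum_(s in B) 1)).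
    apply: ler_sum => s _; rewrite normrM norm_conjC -[1]mulr1.
    by apply: ler_pM.
  by rewrite sumr_const ler_nat.
have HM i : \sum_i' `|K i i'| <= (V * (x %/ D + 1))%N%:R.
  rewrite (bigID (fun i' : 'I_x => (D %| i%:Z - i'%:Z)%Z)) /= [X in _ + X]big1 ?addr0; last first.
    move=> i' nD; apply/eqP; rewrite normr_eq0; apply: contraNT nD; exact: K0.
  apply: (@le_trans _ _ (\sum_(i' < x | (D %| i%:Z - i'%:Z)%Z) V%:R)); first by apply: ler_sum.
  rewrite sumr_const -mulrnA ler_nat leq_mul2l; apply/orP; right.
  by rewrite -cardsE; apply: card_residue.
have M0 : 0 < (V * (x %/ D + 1))%N%:R :> C by rewrite ltr0n muln_gt0 V0 addn1.
have := dual_large_sieve (fun s => (N s)%:R) M0 HM.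
rewrite colE -natrM; apply: le_trans.
rewrite big_mkcond /=; apply: ler_sum => i _; case: ifP => [Pi|_]; last by rewrite exprn_ge0.
rewrite -sumN big_seq (eq_bigr (fun h => phi i (code h))) -?big_seq // => h hin.
exact: evE.
Qed.

End LargeSieve.

(** * Short character sums *)

Lemma valid_levels_sumn k W ws : (1 < k)%N -> valid_levels k W ws -> (sumn ws < W)%N.
Proof.
move=> k1; elim: ws W => [|w ws IH] W //= /and3P[w0 kw /IH]; nia.
Qed.

Lemma window_shift (C : numClosedFieldType) (f : nat -> C) (b N : nat) :
  (forall i, `|f i| <= 1) ->
  `|\sum_(i < N) f (b + i)%N - \sum_(i < N) f i| <= b.*2%:R.
Proof.
move=> Hf; elim: b => [|b IH].
  by under eq_bigr => i _ do rewrite add0n; rewrite subrr normr0.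
have E : \sum_(i < N) f (b.+1 + i)%N = \sum_(i < N) f (b + i)%N + f (b + N)%N - f b.
  have := @big_ord_recr C 0 +%R N (fun i : 'I_N.+1 => f (b + i)%N).
  rewrite big_ord_recl /= addn0 => <-; rewrite [RHS]addrAC subrr add0r.
  by apply: eq_bigr => i _; rewrite addSnnS.
rewrite E (_ : _ - _ = \sum_(i < N) f (b + i)%N - \sum_(i < N) f i + (f (b + N)%N - f b)); last by ring.
rewrite doubleS -addn2 natrD; apply: le_trans (ler_normD _ _) _; apply: lerD => //.
by apply: le_trans (ler_normB _ _) _; rewrite (natrD _ 1 1) lerD.
Qed.

Lemma sum_split_mod (V : nmodType) (p r : nat) (F : nat -> V) :
  (0 < p)%N -> \sum_(y < p * r) F y = \sum_(a < p) \sum_(y < r) F (a + p * y)%N.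
Proof.
move=> p0; rewrite exchange_big /=; elim: r => [|r IH]; first by rewrite muln0 !big_ord0.
rewrite big_ord_recr /= -IH mulnS addnC big_split_ord /=; congr (_ + _).
by apply: eq_bigr => i _; rewrite addnC.
Qed.

(** * From one large sum to a large sum over the products of all levels *)

Section LevelPath.

Variables (C : numClosedFieldType) (Q : nat) (chi : int -> C).
Hypothesis Q_gt0 : (0 < Q)%N.
Hypothesis chi_per : forall m n : int, (Q %| m - n)%Z -> chi m = chi n.
Hypothesis chiM : forall m n : int, chi (m * n) = chi m * chi n.
Hypothesis chi_eq0 : forall n : int, (chi n == 0) = ~~ coprimez n Q.
Variables (q k d : nat).
Hypothesis q_gt0 : (0 < q)%N.
Hypothesis k_gt1 : (1 < k)%N.

Let chi_le1 := char_norm_le1 Q_gt0 chi_per chiM chi_eq0.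

(** In [level_path], [P] accumulates the factors [q ^ w] of the earlier levels: a unit step of a
    variable at the current level moves the argument by [d * P]. *)
Definition level_sum (W P : nat) (v : int) : C :=
  \sum_(y < q ^ W) chi (v + (d * P * y)%N%:Z).

Lemma level_sum_shift W P v b :
  `|level_sum W P (v + (d * P * b)%N%:Z) - level_sum W P v| <= b.*2%:R.
Proof.
have := window_shift b (q ^ W) (fun i => chi_le1 (v + (d * P * i)%N%:Z)).
rewrite /level_sum; under eq_bigr => i _ do rewrite mulnDr PoszD addrA.
exact.
Qed.

Lemma level_sum_split W P v w : (w <= W)%N ->
  level_sum W P v = \sum_(a < q ^ w) level_sum (W - w) (P * q ^ w) (v + (d * P * a)%N%:Z).
Proof.
move=> wW.
have -> : level_sum W P v = \sum_(y < q ^ w * q ^ (W - w)) chi (v + (d * P * y)%N%:Z).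
  by rewrite /level_sum -expnD subnKC.
rewrite (sum_split_mod _ (fun y => chi (v + (d * P * y)%N%:Z))) ?expn_gt0 ?q_gt0 //.
apply: eq_bigr => a _; apply: eq_bigr => y _; congr chi.
by rewrite mulnDr PoszD -addrA; congr (_ + (_ + Posz _)); rewrite !mulnA.
Qed.

Lemma level_sum_norm W P v : `|level_sum W P v| <= (q ^ W)%:R.
Proof.
apply: le_trans (ler_norm_sum _ _ _) _; apply: le_trans (ler_sum _ (fun i _ => chi_le1 _)) _.
by rewrite sumr_const card_ord.
Qed.

Lemma sum_pigeonhole (N : nat) (F : 'I_N -> C) (a : C) :
  (0 < N)%N -> a *+ N <= `|\sum_i F i| -> a \is Num.real -> exists i, a <= `|F i|.
Proof.
move=> N0 H ar; case: (boolP [exists i, a <= `|F i|]) => [/existsP //|nE].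
have lt i : `|F i| < a.
  by rewrite real_ltNge ?normr_real //; apply: contra nE => aF; apply/existsP; exists i.
have : `|\sum_i F i| < a *+ N.
  apply: le_lt_trans (ler_norm_sum _ _ _) _.
  rewrite -[N in X in _ < X]card_ord -sumr_const; apply: ltr_sum => [|i _]; last exact: lt.
  by apply/hasP; exists (Ordinal N0) => //; rewrite mem_index_enum.
by move=> /lt_geF; rewrite H.
Qed.

(* The residue classes with a small sum contribute at most half of the total. *)
Lemma level_sum_classes W P v : (0 < W)%N ->
  (k.*2 * q ^ W)%:R <= q%:R * `|level_sum W P v| ->
  exists c : {ffun 'I_k -> 'I_q}, injective c /\ forall i,
    (q ^ W.-1)%:R <= q%:R * `|level_sum W.-1 (P * q) (v + (d * P * c i)%N%:Z)|.
Proof.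
move=> W0 H.
pose S (c : 'I_q) := level_sum W.-1 (P * q) (v + (d * P * c)%N%:Z).
pose G := [set c : 'I_q | (k * q ^ W.-1)%:R <= q%:R * `|S c|].
have split : level_sum W P v = \sum_c S c.
  by rewrite (@level_sum_split W P v 1) // expn1 subn1.
have qW : (q ^ W = q * q ^ W.-1)%N by rewrite -expnS prednK.
have kG : (k <= #|G|)%N.
  have : (k.*2 * q ^ W)%:R <= ((#|G| + k) * q ^ W)%:R :> C.
    apply: le_trans H _; rewrite split.
    apply: (@le_trans _ _ (q%:R * \sum_c `|S c|)).
      by rewrite ler_wpM2l // ler_norm_sum.
    rewrite mulr_sumr (bigID (mem G)) /= mulnDl natrD lerD //.
      apply: (@le_trans _ _ (\sum_(i in G) q%:R * (q ^ W.-1)%:R)).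
        by apply: ler_sum => c _; rewrite ler_wpM2l // level_sum_norm.
      by rewrite sumr_const -natrM -qW -mulrnA mulnC.
    apply: (@le_trans _ _ (\sum_(i < q | i \notin G) (k * q ^ W.-1)%:R)).
      apply: ler_sum => c; rewrite inE -real_ltNge ?realM ?realn ?normr_real //.
      by move/ltW.
    rewrite (eq_bigl (fun i => i \in ~: G)) => [|i]; last by rewrite [RHS]inE.
    rewrite sumr_const -mulrnA ler_nat qW -mulnA leq_mul2l; apply/orP; right.
    by rewrite mulnC leq_mul2r (leq_trans (max_card _)) ?card_ord ?orbT.
  by rewrite ler_nat leq_pmul2r ?expn_gt0 ?q_gt0 // -addnn leq_add2r.
pose c := [ffun i : 'I_k => enum_val (widen_ord kG i)].
exists c; split.
  by move=> i j; rewrite !ffunE => /enum_val_inj/(congr1 val)/= /val_inj.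
move=> i; have : c i \in G by rewrite ffunE enum_valP.
rewrite inE; apply: le_trans; rewrite ler_nat leq_pmull // ltnW //.
Qed.

(** Since [n * vb = 1] modulo [Q] and [chi n] is unimodular, the factor [1 + y * x] may be replaced
    by [n + d P y]. The variables of the level are independent, so their sum factors. *)
Lemma level_product W w P (c : {ffun 'I_k -> 'I_q}) (gs : seq {poly int}) (n vb : int) :
  (0 < W)%N -> (Q %| n * vb - 1)%Z ->
  `|\sum_(h <- level_step w W c gs) chi h.[(d * P)%N%:Z * vb]| =
  (\prod_i `|level_sum W.-1 (P * q) (n + (d * P * c i)%N%:Z)|) *
  `|\sum_(g <- gs) chi g.[(d * (P * q ^ w))%N%:Z * vb]|.
Proof.
move=> W0 Qn.
have cn : coprimez n Q.
  have /dvdzP[r rE] := Qn.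
  by apply/coprimezP; exists (vb, - r) => /=; rewrite mulNr -rE; ring.
set x := (d * P)%N%:Z * vb.
have term (c0 : 'I_q) (N : nat) :
    `|\sum_(t < N) chi (1 + (c0 + q * t)%N%:Z * x)| =
    `|\sum_(t < N) chi (n + (d * P * c0)%N%:Z + (d * (P * q) * t)%N%:Z)|.
  rewrite -[LHS]mul1r -(char_norm1 Q_gt0 chi_per chiM chi_eq0 cn) -normrM mulr_sumr.
  congr `|_|; apply: eq_bigr => t _; rewrite -chiM; apply: chi_per.
  rewrite (_ : _ - _ = (n * vb - 1) * ((d * P)%N%:Z * (c0 + q * t)%N%:Z)); first exact: dvdz_mulr.
  by rewrite /x !(PoszD, PoszM); ring.
have lin (y : 'I_k -> int) : chi (lin_prod y).[x] = \prod_i chi (1 + y i * x).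
  rewrite /lin_prod horner_prod (big_morph chi chiM (char1 chiM chi_eq0)).
  by apply: eq_bigr => i _; rewrite !hornerE.
rewrite /level_step big_allpairs_dep big_enum /=.
have -> : \sum_(i in {ffun 'I_k -> 'I_(q ^ W.-1)}) \sum_(h <- gs)
    chi (lin_prod (level_var c i) * dilate (q ^ w) h).[x] =
  (\sum_(z : {ffun 'I_k -> 'I_(q ^ W.-1)}) \prod_i chi (1 + level_var c z i * x)) *
   \sum_(g <- gs) chi g.[(d * (P * q ^ w))%N%:Z * vb].
  rewrite mulr_suml; apply: eq_big => // z _; rewrite mulr_sumr; apply: eq_bigr => g _.
  rewrite hornerM chiM lin horner_dilate; congr (_ * chi _.[_]).
  by rewrite /x !PoszM; ring.
rewrite -(bigA_distr_bigA (fun i (t : 'I_(q ^ W.-1)) => chi (1 + (c i + q * t)%N%:Z * x))).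
rewrite normrM normr_prod; congr (_ * _); apply: eq_bigr => i _.
exact: term.
Qed.

(** The later levels fix the centre: a class [a] modulo [q ^ w] is selected, the recursion finds
    [b'] inside it, and only then is the current level recentred at [b = a + q ^ w * b']. Each of
    its [k] factors is within a factor [q] of the number of its terms, whence
    [q ^ (k * size ws)]. *)
Lemma level_path W P v ws :
  valid_levels k W ws ->
  (k.+1.*2 * q ^ W)%:R <= q%:R * `|level_sum W P v| ->
  exists b : nat, exists cs : seq {ffun 'I_k -> 'I_q},
   [/\ (b < q ^ sumn ws)%N, size cs = size ws, {in cs, forall c : {ffun 'I_k -> 'I_q}, injective c} &
    forall vb : int, (Q %| (v + (d * P * b)%N%:Z) * vb - 1)%Z ->
     (size (level_polys W ws cs))%:R <= q%:R ^+ (k * size ws) *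
       `|\sum_(h <- level_polys W ws cs) chi h.[(d * P)%N%:Z * vb]| ].
Proof.
elim: ws W P v => [|w ws IH] W P v.
  move=> _ _; exists 0%N, [::]; split => // vb _.
  by rewrite /= big_seq1 hornerC (char1 chiM chi_eq0) normr1 muln0 mulr1.
move=> V H; have sW := valid_levels_sumn k_gt1 V.
have /= /and3P[w0 kwW V'] := V.
have wW : (w <= W)%N by rewrite (leq_trans _ kwW) // leq_pmull // ltnW.
have W0 : (0 < W)%N by exact: leq_ltn_trans sW.
(* Some class has at least the average size, so the relative size of the sum survives unchanged
   through all levels. *)
have [a Ha] : exists a : 'I_(q ^ w), (k.+1.*2 * q ^ (W - w))%:R <=
    `|q%:R * level_sum (W - w) (P * q ^ w) (v + (d * P * a)%N%:Z)|.
  apply: sum_pigeonhole; rewrite ?expn_gt0 ?q_gt0 ?realn //.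
  rewrite -mulr_sumr -level_sum_split // normrM normr_nat -mulrnA; apply: le_trans H.
  by rewrite ler_nat -mulnA -expnD subnK.
have [|b' [cs [b'lt sz cinj Hcs]]] := IH _ (P * q ^ w)%N (v + (d * P * a)%N%:Z) V'.
  by apply: le_trans Ha _; rewrite normrM normr_nat.
pose b := (a + q ^ w * b')%N.
have blt : (b < q ^ sumn (w :: ws))%N.
  rewrite /= expnD /b; apply: (@leq_trans (q ^ w + q ^ w * b')).
    by rewrite ltn_add2r.
  by rewrite -mulnS leq_mul2l b'lt orbT.
have bE : v + (d * P * a)%N%:Z + (d * (P * q ^ w) * b')%N%:Z = v + (d * P * b)%N%:Z.
  by rewrite /b -addrA -PoszD mulnDr !mulnA.
have bq : (b * q <= q ^ W)%N.
  apply: (@leq_trans (q ^ (sumn (w :: ws)).+1)); first by rewrite expnSr leq_mul2r ltnW ?orbT.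
  by rewrite leq_pexp2l.
(* Recentring changes the sum by at most [2 b], and [b * q <= q ^ W]; this loss is the difference
   between the thresholds [k.+1.*2] and [k.*2]. *)
have [|c [c_inj Hc]] := @level_sum_classes W P (v + (d * P * b)%N%:Z) W0.
  have Hs := level_sum_shift W P v b.
  have : `|level_sum W P v| <= `|level_sum W P (v + (d * P * b)%N%:Z)| + b.*2%:R.
    rewrite -lerBlDl; apply: le_trans Hs; rewrite distrC.
    exact: lerB_dist.
  move=> H1; have {}H1 : q%:R * `|level_sum W P v| <=
      q%:R * `|level_sum W P (v + (d * P * b)%N%:Z)| + (q ^ W).*2%:R.
    apply: (@le_trans _ _ (q%:R * (`|level_sum W P (v + (d * P * b)%N%:Z)| + b.*2%:R))).
      by rewrite ler_wpM2l.
    by rewrite mulrDr lerD2l -natrM ler_nat mulnC -doubleMl leq_double.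
  have := le_trans H H1; rewrite doubleS mulSn mulSn addnA addnn addnC natrD lerD2r.
  exact.
exists b, (c :: cs); split => //=; first by rewrite sz.
  by move=> c'; rewrite inE => /orP[/eqP -> //|]; apply: cinj.
move=> vb vbE; rewrite (level_product _ _ _ _ W0 vbE) mulnS exprD /level_step size_allpairs.
rewrite -cardE card_ffun !card_ord natrM mulrACA.
apply: ler_pM => //; last by apply: Hcs; rewrite bE.
rewrite -[X in _ ^+ X * _]card_ord -prodr_const -big_split /= natrX -[X in _ ^+ X]card_ord -prodr_const.
by apply: ler_prod => i _; rewrite ler0n Hc.
Qed.

End LevelPath.

Fixpoint level_size (q k W : nat) (ws : seq nat) : nat :=
  if ws is w :: ws' then ((q ^ W.-1) ^ k * level_size q k (W - w) ws')%N else 1%N.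

Lemma size_level_polysE q k W ws (cs : seq {ffun 'I_k -> 'I_q}) :
  size cs = size ws -> size (level_polys W ws cs) = level_size q k W ws.
Proof.
elim: ws W cs => [|w ws IH] W [|c cs] //= [sz].
by rewrite -(IH _ cs) // /level_step size_allpairs -cardE card_ffun !card_ord.
Qed.

Lemma level_size_gt0 q k W ws : (0 < q)%N -> (0 < level_size q k W ws)%N.
Proof.
by move=> q0; elim: ws W => //= w ws IH W; rewrite muln_gt0 !expn_gt0 q0 IH.
Qed.

Definition zinv (Q : nat) (n : int) : int := (egcdz n Q).1.

Lemma zinvP (Q : nat) (n : int) : coprimez n Q -> (Q %| n * zinv Q n - 1)%Z.
Proof.
rewrite /zinv /coprimez; case: egcdzP => u v /= E _ /eqP G.
by rewrite (_ : n * u - 1 = - v * Q%:Z); [rewrite dvdz_mull|rewrite -G -E; ring].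
Qed.

Section ShortSums.

Variables (C : numClosedFieldType) (Q : nat) (chi : int -> C).
Hypothesis Q_gt0 : (0 < Q)%N.
Hypothesis chi_per : forall m n : int, (Q %| m - n)%Z -> chi m = chi n.
Hypothesis chiM : forall m n : int, chi (m * n) = chi m * chi n.
Hypothesis chi_eq0 : forall n : int, (chi n == 0) = ~~ coprimez n Q.
Hypothesis chi_prim : forall g : nat, (g %| Q)%N ->
  (forall m n : int, (g %| m - n)%Z -> chi m = chi n) ->
  (forall n : int, (chi n == 0) = ~~ coprimez n g) -> g = Q.
Variables (q k d D W : nat) (ws : seq nat) (j1 j2 : 'I_k).
Hypothesis q_pr : prime q.
Hypothesis k_gt1 : (1 < k)%N.
Hypothesis ws_valid : valid_levels k W ws.
Hypothesis ws_last : (W - sumn ws < k)%N.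
Hypothesis ws_size : (k * size ws < q)%N.
Hypothesis D_gt0 : (0 < D)%N.
Hypothesis d_gt0 : (0 < d)%N.
Hypothesis D_d : (D %| d)%N.
Hypothesis D_Q : (D %| Q)%N.
Hypothesis Q_d : (Q %| d ^ k.+1)%N.
Hypothesis j12 : (j1.+1 = j2)%N.
Hypothesis j1_large : (k < j1.+1.*2)%N.
Hypothesis d_small : (d ^ (k - j1) <= q ^ (W * j1.+1))%N.
Hypothesis D_div : forall j, j \in [:: j1; j2] ->
  forall e, (Q %| d%:Z ^+ j.+1 * e)%Z -> (D %| e)%Z.

(** At [j1] and [j2] the side is rounded up to a multiple of [d ^ (k - j)]: multiplied by [d ^ j.+1]
    it becomes divisible by [Q], so the sums over these coordinates run over full periods. By
    [d_small] the rounding at most doubles the side. *)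
Definition box_side (j : 'I_k) : nat :=
  if j \in [:: j1; j2] then
    (d ^ (k - j) * ((q ^ W.+1) ^ j.+1 %/ d ^ (k - j)).+1)%N
  else ((q ^ W.+1) ^ j.+1)%N.

Lemma box_side_ge (j : 'I_k) : ((q ^ W.+1) ^ j.+1 <= box_side j)%N.
Proof.
rewrite /box_side; case: ifP => // _.
by rewrite mulnC ltnW // ltn_ceil // expn_gt0 d_gt0.
Qed.

Lemma box_side_le (j : 'I_k) :
  (box_side j <= (if j \in [:: j1; j2] then 2 else 1) * (q ^ W.+1) ^ j.+1)%N.
Proof.
rewrite /box_side; case: ifP => [jin|_]; last by rewrite mul1n.
have q0 := prime_gt0 q_pr.
have jj : (j1 <= j)%N by move: jin; rewrite !inE => /orP[] /eqP -> //; rewrite -j12.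
rewrite mulnS mul2n -addnn leq_add //; last by rewrite mulnC leq_trunc_div.
apply: (@leq_trans (d ^ (k - j1))); first by rewrite leq_pexp2l // leq_sub2l.
apply: leq_trans d_small _; rewrite -expnM leq_pexp2l //.
by rewrite leq_mul.
Qed.

Lemma prod_box_side : (\prod_j box_side j <= 4 * q ^ (W.+1 * 'C(k.+1, 2)))%N.
Proof.
apply: leq_trans (leq_prod (fun j _ => box_side_le j)) _.
rewrite big_split /=; apply: leq_mul.
  rewrite -big_mkcond /= (bigD1 j1) ?mem_head //= (bigD1 j2) /=; last first.
    rewrite !inE eqxx orbT /=; apply/eqP => E; have := congr1 val E; rewrite /= -j12.
    by move/eqP; rewrite -[X in _ == X]addn0 -addn1 eqn_add2l.
  rewrite big1 // => i; rewrite !inE => /andP[/andP[H n1] n2].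
  by move: H; rewrite (negPf n1) (negPf n2).
rewrite -expn_sum -expnM leq_pexp2l ?prime_gt0 // leq_mul2l; apply/orP; right.
by rewrite -bin2_sum big_mkord big_ord_recl add0n.
Qed.

Lemma level_polys_box (cs : seq {ffun 'I_k -> 'I_q}) h : size cs = size ws -> h \in level_polys W ws cs ->
  h`_0 = 1 /\ forall j : 'I_k, 0 <= h`_j.+1 < box_side j.
Proof.
move=> sz hin; split; first exact: level_polys0 hin.
move=> j; have := level_polys_bounded (prime_gt0 q_pr) (ltnW k_gt1) ws_valid hin.
move=> /(_ j.+1)/andP[-> H] /=; apply: le_lt_trans H _.
rewrite -PoszX ltz_nat; apply: leq_trans (box_side_ge j).
(* The extra power of [q] in the sides absorbs the number [k * size ws < q] of variables. *)
by rewrite ltn_exp2r // expnS ltn_pmul2r // expn_gt0 prime_gt0.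
Qed.

Lemma level_polys_sieve (x : nat) (m : int) (vb : 'I_x -> int) (cs : seq {ffun 'I_k -> 'I_q}) :
  size cs = size ws -> {in cs, forall c : {ffun 'I_k -> 'I_q}, injective c} ->
  (forall i : 'I_x, coprimez (m + i%:Z) Q -> (Q %| (m + i%:Z) * vb i - 1)%Z) ->
  (\sum_(i < x | coprimez (m + i%:Z) Q)
     `|\sum_(h <- level_polys W ws cs) chi h.[d%:Z * vb i]| ^+ 2) *
   (q ^ (sumn ws * 'C(k.+1, 2)))%:R <=
  ((4 * q ^ (W.+1 * 'C(k.+1, 2))) * (x %/ D + 1) *
    (level_size q k W ws ^ 2 * q ^ (k * size ws)))%N%:R.
Proof.
move=> sz cinj vbE.
have S := char_large_sieve Q_gt0 chi_per chiM chi_eq0 chi_prim D_gt0 D_d D_Q Q_d j12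
  j1_large (L := box_side) (v := fun i : 'I_x => m + i%:Z) (vb := vb) (m := m)
  (hs := level_polys W ws cs).
have {}S := S _ _ (fun=> erefl) vbE (fun h => level_polys_box sz).
have := collisions_level_polys q_pr (ltnW k_gt1) ws_valid sz cinj.
rewrite size_level_polysE // => Hc.
apply: (@le_trans _ _ (((\prod_j box_side j) * (x %/ D + 1) *
   collisions k.+1 (level_polys W ws cs))%N%:R * (q ^ (sumn ws * 'C(k.+1, 2)))%:R)).
  rewrite ler_wpM2r //; apply: S => [j|j jin].
    by apply: leq_trans (box_side_ge j); rewrite !expn_gt0 prime_gt0.
  split; last exact: D_div.
  rewrite /box_side jin mulnA -expnD dvdn_mulr // addSn subnKC //.
  exact: ltnW.
rewrite -natrM ler_nat -mulnA; apply: leq_mul => //.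
by rewrite leq_mul // prod_box_side.
Qed.

Let big_sum m := (k.+1.*2 * q ^ W)%:R <= q%:R * `|level_sum chi q d W 1 m|.

(** Each exceptional index produces some [b] and [cs] with a nearly maximal product sum, and the
    sieve is summed over all such pairs. Of the exponent [4 (k r)], with [r = size ws], one part
    counts the [cs], two come from squaring the loss in [level_path], and one from the collisions.
    The choices of [b] give at most [q ^ W], and the depth not covered by the levels gives
    [k * 'C(k.+1, 2)]. *)
Lemma big_sum_card (x : nat) (m : int) :
  (#|[set i : 'I_x | big_sum (m + i%:Z)]| <=
    4 * q ^ (4 * (k * size ws) + W + k * 'C(k.+1, 2)) * (x %/ D + 1))%N.
Proof.
have q0 := prime_gt0 q_pr.
have sW := valid_levels_sumn k_gt1 ws_valid.
set E := [set i | _].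
pose S := sumn ws; pose r := size ws; pose R := (r.-tuple {ffun 'I_k -> 'I_q})%type.
pose good (cs : R) := all (fun c : {ffun 'I_k -> 'I_q} => injectiveb c) cs.
pose T (m' : int) (cs : R) : C := \sum_(i < x | coprimez (m' + i%:Z) Q)
  `|\sum_(h <- level_polys W ws cs) chi h.[d%:Z * zinv Q (m' + i%:Z)]| ^+ 2.
pose Sz := level_size q k W ws.
have shift n (u : int) : coprimez n Q -> coprimez (n + d%:Z * u) Q.
  move=> cn; have Qn := zinvP cn; set nb := zinv Q n in Qn.
  rewrite -[coprimez _ _]negbK -chi_eq0.
  rewrite (@chi_per _ (n * (1 + d%:Z * (u * nb)))); last first.
    rewrite (_ : _ - _ = (n * nb - 1) * (- (d%:Z * u))); [exact: dvdz_mulr|ring].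
  rewrite chiM mulf_eq0 !chi_eq0 cn /= negbK (@coprimez_1D Q k.+1) //.
  by rewrite -PoszX dvdzE.
have step : (#|E| * Sz ^ 2)%N%:R <=
    \sum_(b < q ^ S) \sum_(cs : R | good cs) (q%:R ^+ (k * r)) ^+ 2 * T (m + (d * b)%N%:Z) cs.
  apply: (@le_trans _ _ (\sum_(i in E) \sum_(b < q ^ S) \sum_(cs : R | good cs)
      (if coprimez (m + (d * b)%N%:Z + i%:Z) Q then (q%:R ^+ (k * r)) ^+ 2 *
       `|\sum_(h <- level_polys W ws cs) chi h.[d%:Z * zinv Q (m + (d * b)%N%:Z + i%:Z)]| ^+ 2
       else 0))); last first.
    rewrite exchange_big /=; apply: ler_sum => b _; rewrite exchange_big /=.
    apply: ler_sum => cs _; rewrite /T mulr_sumr [X in _ <= X]big_mkcond /=.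
    rewrite [X in X <= _]big_mkcond /=; apply: ler_sum => i _; case: ifP => // _.
    by case: ifP => // _; rewrite mulr_ge0 ?exprn_ge0.
  rewrite mulnC natrM mulr_natr -sumr_const; apply: ler_sum => i; rewrite inE => Hi.
  have ci : coprimez (m + i%:Z) Q.
    apply/negPn/negP => nc; move: Hi; rewrite /big_sum /level_sum big1 => [|y _]; last first.
      apply/eqP; rewrite chi_eq0; apply: contra nc => cy.
      rewrite (_ : m + i%:Z = m + i%:Z + (d * 1 * y)%N%:Z + d%:Z * (- y%:Z)).
        exact: shift.
      by rewrite muln1 PoszM; ring.
    rewrite normr0 mulr0 lern0 muln_eq0 expn_eq0 double_eq0 /=.
    by case: (q) q0.
  have [b [cs [blt sz cinj Hcs]]] := level_path Q_gt0 chi_per chiM chi_eq0 q0 k_gt1 ws_valid Hi.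
  have csr : size cs == r by apply/eqP.
  have bE : m + i%:Z + (d * 1 * b)%N%:Z = m + (d * b)%N%:Z + i%:Z by rewrite muln1 addrAC.
  have cb : coprimez (m + (d * b)%N%:Z + i%:Z) Q by rewrite addrAC PoszM shift.
  rewrite bE in Hcs; have := Hcs _ (zinvP cb); rewrite muln1 size_level_polysE // -/Sz => H.
  have gcs : good (Tuple csr) by apply/allP => c /cinj /injectiveP.
  rewrite (bigD1 (Ordinal blt)) //= (bigD1 (Tuple csr)) //= cb -addrA.
  apply: (@le_trans _ _ ((q%:R ^+ (k * r)) ^+ 2 * `|\sum_(h <- level_polys W ws cs)
      chi h.[d%:Z * zinv Q (m + (d * b)%N%:Z + i%:Z)]| ^+ 2)).
    rewrite natrX -exprMn lerXn2r ?nnegrE ?mulr_ge0 ?exprn_ge0 //.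
  rewrite lerDl; apply: addr_ge0.
    by apply: sumr_ge0 => cs' _; rewrite mulr_ge0 ?exprn_ge0.
  apply: sumr_ge0 => b' _; apply: sumr_ge0 => cs' _.
  by case: ifP => // _; rewrite mulr_ge0 ?exprn_ge0.
have cardR : #|{: R}| = (q ^ (k * r))%N by rewrite card_tuple card_ffun !card_ord expnM.
pose X := ((4 * q ^ (W.+1 * 'C(k.+1, 2))) * (x %/ D + 1) * (Sz ^ 2 * q ^ (k * r)))%N.
have : ((#|E| * Sz ^ 2) * q ^ (S * 'C(k.+1, 2)))%N%:R <=
    (q ^ S * (q ^ (k * r) * ((q ^ (k * r)) ^ 2 * X)))%N%:R :> C.
  rewrite natrM; apply: (@le_trans _ _ (\sum_(b < q ^ S) \sum_(cs : R) ((q ^ (k * r)) ^ 2 * X)%N%:R)).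
    apply: le_trans (ler_wpM2r _ step) _ => //.
    rewrite mulr_suml; apply: ler_sum => b _; rewrite mulr_suml.
    rewrite [X in X <= _]big_mkcond /=; apply: ler_sum => cs _; case: ifP => // gcs.
    have T_ge0 : 0 <= T (m + (d * b)%N%:Z) cs by apply: sumr_ge0 => i _; apply: exprn_ge0.
    rewrite -mulrA natrM; apply: ler_pM.
    - by do 2!apply: exprn_ge0.
    - exact: mulr_ge0.
    - by rewrite -!natrX.
    apply: level_polys_sieve; first by rewrite size_tuple.
      by move=> c cin; apply/injectiveP; move/allP: gcs; apply.
    by move=> i; apply: zinvP.
  rewrite !sumr_const card_ord cardR -!mulrnA ler_nat.
  by rewrite [X in (X <= _)%N]mulnC [X in (X * _ <= _)%N]mulnC -mulnA.
rewrite ler_nat /X => H.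
have Sz0 : (0 < Sz ^ 2)%N by rewrite expn_gt0 level_size_gt0.
have := H.
set c := 'C(k.+1, 2); set y := (x %/ D + 1)%N.
have -> : (q ^ S * (q ^ (k * r) * ((q ^ (k * r)) ^ 2 * (4 * q ^ (W.+1 * c) * y * (Sz ^ 2 * q ^ (k * r))))) =
   (4 * q ^ (S + 4 * (k * r) + W.+1 * c) * y) * Sz ^ 2)%N.
  have e4 : (4 * (k * r) = k * r + k * r + k * r + k * r)%N by rewrite !mulSn mul0n addn0 !addnA.
  rewrite e4 !expnD (expnS _ 1) expn1; ring.
rewrite mulnAC leq_pmul2r // => {}H.
rewrite -(@leq_pmul2r (q ^ (S * c))) ?expn_gt0 ?q0 //; apply: leq_trans H _.
rewrite [X in (_ <= X)%N]mulnAC leq_mul // -mulnA -expnD leq_mul // leq_pexp2l //.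
have e : (W.+1 * c <= k * c + S * c)%N.
  by rewrite -mulnDl leq_mul2r; apply/orP; right; have := ws_last; rewrite -/S; move: sW; rewrite -/S; clear; lia.
move: sW e; rewrite -/S -/r; clear; lia.
Qed.

(** The sum is averaged over shifts by [d * y] with [y < q ^ W]. The three terms are the cost of
    shifting, the exceptional positions estimated trivially, and the threshold at all other
    positions. *)
Lemma short_sum_bound (x : nat) (m : int) :
  `|\sum_(i < x) chi (m + i%:Z)| <= (2 * (d * q ^ W))%N%:R +
    (4 * q ^ (4 * (k * size ws) + W + k * 'C(k.+1, 2)) * (x %/ D + 1))%N%:R
    + (k.+1.*2 * x)%N%:R / q%:R.
Proof.
have q0 := prime_gt0 q_pr; have U0 : (0 < q ^ W)%N by rewrite expn_gt0 q0.
have U0' : 0 < (q ^ W)%:R :> C by rewrite ltr0n.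
rewrite -(ler_pM2l U0').
set S := \sum_(i < x) _.
have shiftb (y : 'I_(q ^ W)) : `|S - \sum_(i < x) chi (m + i%:Z + (d * 1 * y)%N%:Z)| <=
    (2 * (d * q ^ W))%N%:R.
  have := window_shift (d * 1 * y)%N x (fun i => char_norm_le1 Q_gt0 chi_per chiM chi_eq0 (m + i%:Z)).
  rewrite distrC /= (eq_bigr (fun i : 'I_x => chi (m + i%:Z + (d * 1 * y)%N%:Z)) (r := index_enum _)
    (F1 := fun i : 'I_x => chi (m + (d * 1 * y + i)%N%:Z))) => [|i _]; last first.
    by rewrite PoszD [_ + i%:Z]addrC addrA.
  move=> H; apply: le_trans H _.
  by rewrite ler_nat -mul2n muln1 leq_mul2l leq_mul2l ltnW ?orbT.
pose L (i : 'I_x) := level_sum chi q d W 1 (m + i%:Z).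
have e1 : (q ^ W)%:R * `|S| <= (q ^ W * (2 * (d * q ^ W)))%N%:R + \sum_i `|L i|.
  have -> : (q ^ W)%:R * `|S| = `|\sum_(y < q ^ W) S|.
    by rewrite sumr_const card_ord normrMn mulr_natl.
  have -> : \sum_(y < q ^ W) S = \sum_(y < q ^ W) (S - \sum_(i < x) chi (m + i%:Z + (d * 1 * y)%N%:Z))
      + \sum_i L i.
    by rewrite sumrB [\sum_i L i]exchange_big /= subrK.
  apply: le_trans (ler_normD _ _) _; apply: lerD; last exact: ler_norm_sum.
  apply: le_trans (ler_norm_sum _ _ _) _.
  apply: le_trans (ler_sum _ (fun y _ => shiftb y)) _.
  by rewrite sumr_const card_ord -mulrnA ler_nat mulnC.
apply: le_trans e1 _; rewrite -addrA mulrDr natrM lerD //.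
rewrite (bigID (fun i : 'I_x => big_sum (m + i%:Z))) /= mulrDr lerD //.
  apply: (@le_trans _ _ (\sum_(i < x | big_sum (m + i%:Z)) (q ^ W)%:R)).
    by apply: ler_sum => i _; apply: (level_sum_norm Q_gt0 chi_per chiM chi_eq0).
  rewrite (eq_bigl (fun i => i \in [set i : 'I_x | big_sum (m + i%:Z)])) => [|i]; last by rewrite [RHS]inE.
  rewrite sumr_const -natrM -mulrnA ler_nat leq_mul //; exact: big_sum_card.
apply: (@le_trans _ _ (\sum_(i < x | ~~ big_sum (m + i%:Z)) (k.+1.*2 * q ^ W)%:R / q%:R)).
  apply: ler_sum => i; rewrite /big_sum -real_ltNge ?realM ?realn ?normr_real // => /ltW H.
  by rewrite ler_pdivlMr ?ltr0n // mulrC.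
apply: (@le_trans _ _ (\sum_(i < x) (k.+1.*2 * q ^ W)%:R / q%:R)).
  rewrite big_mkcond /=; apply: ler_sum => i _; case: ifP => _; first exact: lexx.
  exact: divr_ge0.
rewrite sumr_const card_ord -mulr_natl !natrM.
rewrite le_eqVlt; apply/orP; left; apply/eqP; ring.
Qed.

End ShortSums.

(** * Factoring the modulus and choosing an auxiliary prime *)

Lemma radical_gt0 n : (0 < radical n)%N.
Proof.
rewrite /radical big_seq prodn_cond_gt0 // => p.
by rewrite mem_primes => /andP[/prime_gt0].
Qed.

Lemma dvdn_logn m n : (0 < m)%N -> (0 < n)%N ->
  (forall p, prime p -> (logn p m <= logn p n)%N) -> (m %| n)%N.
Proof.
move=> m0 n0 H; apply/dvdn_partP => // p; rewrite mem_primes => /and3P[pp _ _].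
by rewrite p_part pfactor_dvdn // H.
Qed.

Lemma logn_prod p (s : seq nat) (F : nat -> nat) : (forall x, x \in s -> 0 < F x)%N ->
  logn p (\prod_(x <- s) F x) = (\sum_(x <- s) logn p (F x))%N.
Proof.
elim: s => [|x s IH] H; first by rewrite !big_nil logn1.
have H' y : y \in s -> (0 < F y)%N by move=> ys; apply: H; rewrite inE ys orbT.
rewrite !big_cons lognM ?IH // ?H ?mem_head //.
by rewrite big_seq prodn_cond_gt0.
Qed.

Lemma logn_prod_primes (n : nat) (f : nat -> nat) (p : nat) : prime p ->
  logn p (\prod_(r <- primes n) r ^ f r)%N = if p \in primes n then f p else 0%N.
Proof.
move=> pp; have prim r : r \in primes n -> prime r by rewrite mem_primes => /andP[].
rewrite logn_prod => [|r /prim rp]; last by rewrite expn_gt0 prime_gt0.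
rewrite big_seq.
rewrite (eq_bigr (fun r => if r == p then f p else 0%N)) => [|r /prim rp]; last first.
  by rewrite lognX logn_prime // eq_sym; case: eqP => [->|_]; rewrite ?muln1 ?muln0.
rewrite -big_seq -big_mkcond /=; case: ifP => pin.
  rewrite big_mkcond (bigD1_seq p) ?primes_uniq //= eqxx big1 ?addn0 // => r /negPf ->.
  by [].
by rewrite big_seq_cond big1 // => r /andP[rin /eqP rp]; rewrite rp pin in rin.
Qed.

(* [D] is roughly [Q^(1/K)]; the exponents are lowered by one so that the last clause
   also holds for the primes whose multiplicity in [Q] is between [K] and [2 K]. *)
Lemma conductor_factor (Q K : nat) : (0 < Q)%N -> (0 < K)%N ->
  exists D d : nat, [/\ d = (D * radical Q ^ 2)%N, (0 < D)%N, (D ^ K %| Q)%N, (Q %| d ^ K)%N &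
    forall (j : nat) (e : int), (3 * j < 2 * K)%N ->
      (Q %| d%:Z ^+ j * e)%Z -> (D %| e)%Z].
Proof.
move=> Q0 K0; pose D := (\prod_(p <- primes Q) p ^ (logn p Q %/ K).-1)%N.
have D0 : (0 < D)%N.
  rewrite /D big_seq prodn_cond_gt0 // => p; rewrite mem_primes => /andP[/prime_gt0 p0 _].
  by rewrite expn_gt0 p0.
have r0 := radical_gt0 Q.
have lD p : prime p -> logn p D = (logn p Q %/ K).-1.
  move=> pp; rewrite logn_prod_primes //; case: ifP => // /negbT.
  by rewrite -logn_gt0 -eqn0Ngt => /eqP ->; rewrite div0n.
have lr p : prime p -> logn p (radical Q) = (0 < logn p Q)%N.
  move=> pp; have -> : radical Q = (\prod_(r <- primes Q) r ^ 1)%N by [].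
  by rewrite (logn_prod_primes _ (fun=> 1%N)) // logn_gt0; case: ifP.
pose d := (D * radical Q ^ 2)%N.
have d0 : (0 < d)%N by rewrite muln_gt0 D0 expn_gt0 r0.
have ld p : prime p -> logn p d = ((logn p Q %/ K).-1 + 2 * (0 < logn p Q))%N.
  by move=> pp; rewrite lognM ?expn_gt0 ?r0 // lognX lD // lr // mulnC.
exists D, d; split => //.
- apply: dvdn_logn => // [|p pp]; first by rewrite expn_gt0 D0.
  rewrite lognX lD // mulnC; apply: leq_trans (leq_trunc_div _ K).
  by rewrite leq_mul2r leq_pred orbT.
- apply: dvdn_logn => // [|p pp]; first by rewrite expn_gt0 d0.
  rewrite lognX ld //; case: (posnP (logn p Q)) => [->//|l0] /=.
  rewrite muln1; have := ltn_ceil (logn p Q) K0.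
  set f := (logn p Q %/ K)%N => /ltnW H; apply: leq_trans H _.
  by rewrite mulnC leq_mul2l; apply/orP; right; lia.
move=> j e jK; have [->|en] := eqVneq e 0; first by rewrite dvdz0.
rewrite !dvdzE abszM abszX /= => H.
have e0 : (0 < `|e|)%N by rewrite absz_gt0.
apply: dvdn_logn => // p pp; rewrite lD //.
have := dvdn_leq_log p (_ : 0 < d ^ j * `|e|)%N H.
rewrite muln_gt0 expn_gt0 d0 e0 => /(_ isT).
rewrite lognM ?expn_gt0 ?d0 // lognX ld //.
have := leq_trunc_div (logn p Q) K; set f := (logn p Q %/ K)%N; set a := logn p Q.
case: (leqP f 1) => [f1|f2]; first by move=> _ _; case: f f1 => [|[]].
move=> fK; have a0 : (0 < a)%N by apply: leq_trans fK; rewrite muln_gt0 K0 andbT ltnW.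
rewrite a0 muln1 => H2; have : (f * K <= j * f.+1 + logn p `|e|)%N.
  apply: leq_trans fK _; apply: leq_trans H2 _; rewrite leq_add2r leq_mul2l.
  by apply/orP; right; lia.
move: f2 jK; clear; move: (logn p `|e|) => x; case: f => [|[|f]] // _ jK H /=.
(* With [F = f + 2] the quotient of the multiplicity by [K], the bound [3 j <= 2 K - 1] gives
   [3 x >= K (F - 2) + F + 1], which is at least [3 (F - 1)] once [K >= 2]; [K = 1] forces
   [j = 0]. *)
have h1 : (3 * j * f.+3 <= (2 * K).-1 * f.+3)%N by rewrite leq_mul2r; apply/orP; right; lia.
case: K => [|[|K]] in jK H h1 *; [lia| |nia].
by have j0 : j = 0%N; [lia|rewrite j0 in H; lia].
Qed.

Lemma exp2_le_bin n : (2 ^ n <= 'C(n.*2, n))%N.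
Proof.
elim: n => // n IH; rewrite doubleS binS !(binS n.*2) expnS mul2n -addnn.
rewrite leq_add //; apply: leq_trans IH _; first by rewrite leq_addl.
by case: n => [|n]; rewrite ?bin0 // binS leq_addr.
Qed.

(** In Legendre's formula each power [p ^ k] contributes at most 1, and nothing once it exceeds
    [2 n]. *)
Lemma prime_power_central_bin p n : prime p -> (0 < n)%N ->
  (p ^ logn p 'C(n.*2, n) <= n.*2)%N.
Proof.
move=> pp n0; have n20 : (0 < n.*2)%N by rewrite double_gt0.
apply: leq_trans (trunc_logP (prime_gt1 pp) n20).
rewrite leq_pexp2l ?prime_gt0 //.
have nn : (n <= n.*2)%N by rewrite -addnn leq_addr.
have := bin_fact nn; rewrite -[X in (X - n)%N]addnn addnK => /(congr1 (logn p)).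
rewrite !lognM ?muln_gt0 ?fact_gt0 ?bin_gt0 // !logn_fact //.
have -> : (\sum_(1 <= k < n.+1) n %/ p ^ k = \sum_(1 <= k < n.*2.+1) n %/ p ^ k)%N.
  rewrite [RHS](@big_cat_nat _ _ _ n.+1) //= [X in (_ + X)%N]big_nat_cond.
  rewrite [X in (_ + X)%N]big1 ?addn0 // => k /andP[/andP[nk _] _].
  by rewrite divn_small // (leq_trans nk) // ltnW // ltn_expl // prime_gt1.
move=> E.
have : (\sum_(1 <= k < n.*2.+1) n.*2 %/ p ^ k <= \sum_(1 <= k < n.*2.+1) (n %/ p ^ k).*2 +
    trunc_log p n.*2)%N.
  have <- : (\sum_(1 <= k < n.*2.+1) (k <= trunc_log p n.*2) = trunc_log p n.*2)%N.
    rewrite big_add1 /= big_mkord sum_ord_ltn; apply/minn_idPr.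
    by apply: leq_trans (ltnW (ltn_expl _ (prime_gt1 pp))) _; apply: trunc_logP (prime_gt1 pp) n20.
  rewrite -big_split /=; apply: leq_sum => k _.
  case: (leqP k (trunc_log p n.*2)) => kl; last first.
    rewrite divn_small //; apply: leq_trans (trunc_log_ltn _ (prime_gt1 pp)) _.
    by rewrite leq_pexp2l // prime_gt0.
  have pk0 : (0 < p ^ k)%N by rewrite expn_gt0 prime_gt0.
  rewrite addn1 -ltnS -doubleS ltn_divLR // -doubleMl ltn_double.
  exact: ltn_ceil.
rewrite -E -(eq_bigr _ (fun i _ => addnn _)) big_split /=.
lia.
Qed.

(** With [n = M^2], if all primes of the central binomial coefficient were at most [M], it would
    have at most [M] prime power factors, each at most [2 n], so [2 ^ n <= (2 n) ^ M]. This
    contradicts [2 M^2 < 2^M], which holds from [M = 7] on and fails at 6. *)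
Lemma exists_prime_between M : (6 < M)%N -> exists2 p, prime p & (M < p <= 2 * M ^ 2)%N.
Proof.
move=> M7; pose n := (M ^ 2)%N; have n0 : (0 < n)%N by rewrite expn_gt0; lia.
case: (boolP (has (fun p => M < p)%N (primes 'C(n.*2, n)))) => [/hasP[p]|/hasPn H].
  rewrite mem_primes => /and3P[pp b0 pd] Mp; exists p => //; rewrite Mp mul2n /=.
  apply: leq_trans (prime_power_central_bin pp n0).
  rewrite -{1}(expn1 p); apply: leq_pexp2l; first exact: prime_gt0.
  by rewrite logn_gt0 mem_primes pp b0 pd.
have b0 : (0 < 'C(n.*2, n))%N by rewrite bin_gt0 -addnn leq_addr.
have sz : (size (primes 'C(n.*2, n)) <= M)%N.
  rewrite -[M](size_iota 1); apply: uniq_leq_size (primes_uniq _) _ => p pin.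
  have /= Hp := H p pin; rewrite mem_iota add1n ltnS [(p <= M)%N]leqNgt Hp andbT; move: pin.
  by rewrite mem_primes => /andP[/prime_gt0].
have : (2 ^ n <= n.*2 ^ M)%N.
  apply: leq_trans (exp2_le_bin n) _; rewrite [X in (X <= _)%N]prod_prime_decomp // prime_decompE big_map /=.
  apply: (@leq_trans (\prod_(p <- primes 'C(n.*2, n)) n.*2)%N).
    rewrite !big_seq; apply: leq_prod => p; rewrite mem_primes => /and3P[pp _ _].
    exact: prime_power_central_bin.
  by rewrite big_const_seq count_predT iter_muln_1 leq_pexp2l // double_gt0.
rewrite /n expnM -mul2n leq_exp2r; last by lia.
suff : (2 * M ^ 2 < 2 ^ M)%N by rewrite ltnNge => /negPf ->.
rewrite -(subnK M7); elim: (M - 7)%N => // m IH.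
rewrite addSn (expnS 2); nia.
Qed.

(** * From character sums to the L-function *)

Local Open Scope complex_scope.

Lemma block_sum (C : numClosedFieldType) (chi : int -> C) (x : nat) (B : C) (m : int) (t : nat) :
  (0 < x)%N -> (forall n, `|chi n| <= 1) ->
  (forall m', `|\sum_(i < x) chi (m' + i%:Z)| <= B) ->
  `|\sum_(i < t) chi (m + i%:Z)| <= B *+ (t %/ x) + x%:R.
Proof.
move=> x0 chi1 HB.
suff H j r m' : (r < x)%N -> `|\sum_(i < j * x + r) chi (m' + i%:Z)| <= B *+ j + x%:R.
  by have := H (t %/ x)%N (t %% x)%N m; rewrite -divn_eq ltn_pmod //; apply.
move=> rx; elim: j m' => [|j IH] m'.
  rewrite mul0n add0n mulr0n add0r; apply: le_trans (ler_norm_sum _ _ _) _.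
  apply: le_trans (ler_sum _ (fun i _ => chi1 _)) _.
  by rewrite sumr_const card_ord ler_nat ltnW.
rewrite mulSn -addnA big_split_ord /= mulrS -addrA.
apply: le_trans (ler_normD _ _) _; apply: lerD; first exact: HB.
by under eq_bigr => i _ do rewrite PoszD addrA; exact: IH.
Qed.

Lemma sum_residues (C : zmodType) (chi : int -> C) (Q : nat) (f : nat -> int) : (0 < Q)%N ->
  (forall m n : int, (Q %| m - n)%Z -> chi m = chi n) ->
  (forall i j, (i < Q)%N -> (j < Q)%N -> (Q %| f i - f j)%Z -> i = j) ->
  \sum_(i < Q) chi (f i) = \sum_(i < Q) chi i%:Z.
Proof.
move=> Q0 per inj.
have lt i : (`|(f i %% Q)%Z|%N < Q)%N.
  have H1 : ((f i %% Q)%Z < Q%:Z) by apply: ltz_pmod.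
  have H2 : 0 <= (f i %% Q)%Z by apply: modz_ge0; lia.
  lia.
have E i : `|(f i %% Q)%Z|%N%:Z = (f i %% Q)%Z.
  by rewrite gez0_abs // modz_ge0 //; lia.
pose h (i : 'I_Q) := Ordinal (lt i).
have hinj : injective h.
  move=> i j /(congr1 (fun o : 'I_Q => (o : nat)%:Z)) /=; rewrite !E => H.
  by apply: val_inj; apply: (inj _ _ (ltn_ord i) (ltn_ord j)); rewrite -eqz_mod_dvd H.
rewrite [RHS](reindex_inj hinj) /=; apply: eq_bigr => i _; apply: per.
by rewrite E -eqz_mod_dvd modz_mod.
Qed.

Lemma sum_nonprincipal (C : numClosedFieldType) (chi : int -> C) (Q : nat) (a m : int) : (0 < Q)%N ->
  (forall m n : int, (Q %| m - n)%Z -> chi m = chi n) ->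
  (forall m n : int, chi (m * n) = chi m * chi n) ->
  coprimez a Q -> chi a != 1 -> \sum_(i < Q) chi (m + i%:Z) = 0.
Proof.
move=> Q0 per mul ca na.
have small i j : (i < Q)%N -> (j < Q)%N -> (Q %| i%:Z - j%:Z)%Z -> i = j.
  by move=> iQ jQ; rewrite -eqz_mod_dvd => /eqP; rewrite !modz_nat !modn_small // => -[].
rewrite (sum_residues (f := fun i => m + i%:Z)) // => [|i j iQ jQ]; last first.
  by rewrite (_ : _ - _ = i%:Z - j%:Z) => [|]; [exact: small|ring].
have : chi a * (\sum_(i < Q) chi i%:Z) = \sum_(i < Q) chi i%:Z.
  rewrite mulr_sumr; under eq_bigr => i _ do rewrite -mul.
  rewrite (sum_residues (f := fun i => a * i%:Z)) // => i j iQ jQ.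
  by rewrite -mulrBr Gauss_dvdzr 1?coprimez_sym //; apply: small.
move=> /eqP; rewrite -subr_eq0 -[X in _ - X]mul1r -mulrBl mulf_eq0 subr_eq0 (negPf na) /=.
by move/eqP.
Qed.

(** The majorant [g] may jump, as it does in [dirichlet_L_bound] where one estimate of the partial
    sums takes over from another. *)
Lemma abel_sum (C : numDomainType) (c : nat -> C) (a g : nat -> C) (N M : nat) :
  (N <= M)%N ->
  (forall n, (N <= n)%N -> `|\sum_(i < n) c i| <= g n) ->
  (forall n, 0 <= a n.+1 <= a n) ->
  `|\sum_(N <= n < M) c n * a n| <= g N * a N *+ 2 + \sum_(N <= n < M) (g n.+1 - g n) * a n.
Proof.
move=> NM Hg Ha; pose s n := \sum_(i < n) c i.
have a0 n : 0 <= a n by have /andP[H /(le_trans H)] := Ha n.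
have key : `|\sum_(N <= n < M) c n * a n - s M * a M + s N * a N| <=
    g N * a N - g M * a M + \sum_(N <= n < M) (g n.+1 - g n) * a n.
  rewrite -(subnKC NM); elim: (M - N)%N => [|j IH].
    by rewrite addn0 !big_geq // sub0r addNr normr0 subrr addr0.
  rewrite addnS !big_nat_recr ?leq_addr //=; set K := (N + j)%N in IH *.
  have sK : s K.+1 = s K + c K by rewrite /s big_ord_recr.
  rewrite (_ : _ + _ = (\sum_(N <= n < K) c n * a n - s K * a K + s N * a N) +
     s K.+1 * (a K - a K.+1)); last by rewrite sK; ring.
  apply: le_trans (ler_normD _ _) _.
  rewrite [X in _ <= X](_ : _ = (g N * a N - g K * a K + \sum_(N <= n < K) (g n.+1 - g n) * a n) +
     g K.+1 * (a K - a K.+1)); last by ring.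
  apply: lerD => //; rewrite normrM.
  have d0 : 0 <= a K - a K.+1 by rewrite subr_ge0; have /andP[] := Ha K.
  by rewrite (ger0_norm d0) ler_wpM2r // Hg // leqW // leq_addr.
have -> : \sum_(N <= n < M) c n * a n =
   (\sum_(N <= n < M) c n * a n - s M * a M + s N * a N) + s M * a M - s N * a N by ring.
apply: le_trans (ler_normB _ _) _.
have e1 : `|s M * a M| <= g M * a M by rewrite normrM (ger0_norm (a0 M)) ler_wpM2r // Hg.
have e2 : `|s N * a N| <= g N * a N by rewrite normrM (ger0_norm (a0 N)) ler_wpM2r // Hg.
apply: le_trans (lerD (ler_normD _ _) (lexx _)) _.
apply: le_trans (lerD (lerD key e1) e2) _.
rewrite le_eqVlt; apply/orP; left; apply/eqP; rewrite mulr2n; ring.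
Qed.

Lemma harmonic_sum_le (R : realType) (N : nat) : (0 < N)%N ->
  \sum_(n < N) (n.+1%:R : R)^-1 <= 1 + ln N%:R.
Proof.
case: N => // N _; elim: N => [|N IH]; first by rewrite big_ord1 ln1 addr0 invr1.
rewrite big_ord_recr /=; apply: le_trans (lerD IH (lexx _)) _.
rewrite -addrA lerD2l.
have p1 : (0 : R) < N.+1%:R by rewrite ltr0n.
have p2 : (0 : R) < N.+2%:R by rewrite ltr0n.
have : ln (N.+1%:R / N.+2%:R : R) <= - N.+2%:R^-1.
  have -> : (N.+1%:R / N.+2%:R : R) = 1 + - N.+2%:R^-1.
    have nz : (N.+2%:R : R) != 0 by rewrite gt_eqF.
    by apply: (mulIf nz); rewrite mulfVK // mulrDl mulNr mulVf // mul1r -[in RHS]natr1 addrK.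
  by apply: le_ln1Dx; rewrite ltrN2 invf_lt1 // ltr1n.
by rewrite ln_div ?posrE // lerBlDr [- _ + _]addrC lerBrDr.
Qed.

Lemma natcpow_real (R : realType) (n : nat) (t : R) :
  natcpow n (- t%:C) = (expR (- (t * ln n%:R)))%:C.
Proof.
rewrite /natcpow -rmorphN -rmorphM /cexp /= cos0 sin0 mulNr.
by rewrite -[1 +i* 0]/(1%:C) rmorph1 mulr1.
Qed.

(* No convergence is needed: [limn] of a divergent sequence is 0. *)
Lemma norm_limn_le (R : realType) (u : nat -> (R[i] : numFieldType)) (b : R) :
  0 <= b -> (forall n, `|u n| <= b%:C) -> `|limn u| <= b%:C.
Proof.
move=> b0 Hu; have [cu|ncu] := pselect (cvgn u); last first.
  by rewrite (dvgP ncu) normr0 lecR.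
apply/negPn/negP => nle.
have e0 : 0 < `|limn u| - b%:C.
  by rewrite subr_gt0 real_ltNge ?normr_real // ?realE ?lecR ?b0.
move/cvgrPdist_lt: cu => /(_ _ e0)[n _ /(_ n (leqnn n))] H.
have : `|limn u| < `|limn u|.
  rewrite -{1}(subrK (u n) (limn u)); apply: le_lt_trans (ler_normD _ _) _.
  by rewrite -ltrBrDr; apply: lt_le_trans H _; rewrite lerB.
by rewrite ltxx.
Qed.

(** Of the coefficients [n ^ (- s)] only monotonicity and the bound [1 / n] are used, so the
    estimate is uniform in [y]. The constant 4 is 1 from the harmonic head, 2 from the boundary term
    of [abel_sum], and 1 from the jump of [g] at [Q], of height at most [Q] and weight at most
    [1 / (Q + 1)]. *)
Lemma dirichlet_L_bound (R : realType) (chi : int -> R[i]) (Q N : nat) (delta y : R) :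
  (0 < Q)%N -> (0 < N)%N -> 0 <= delta <= 1 -> 3 < y ->
  (forall n, `|chi n| <= 1) ->
  (forall t, `|\sum_(i < t) chi (1 + i%:Z)| <= Q%:R) ->
  (forall t, (N <= t <= Q)%N -> `|\sum_(i < t) chi (1 + i%:Z)| <= (delta * t%:R)%:C) ->
  `|dirichlet_L (1 + (ln y)^-1)%:C chi| <= (ln N%:R + delta * (1 + ln Q%:R) + 4)%:C.
Proof.
move=> Q0 N0 /andP[d0 d1] y3 chi1 HQ HN.
have lnN : 0 <= ln (N%:R : R) by rewrite ln_ge0 // ler1n.
have lnQ : 0 <= ln (Q%:R : R) by rewrite ln_ge0 // ler1n.
have lny : 0 < ln y by rewrite ln_gt0 //; lra.
set sg := 1 + (ln y)^-1.
have sg1 : 1 <= sg by rewrite lerDl invr_ge0 ltW.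
pose ar n : R := expR (- (sg * ln (n.+1%:R))).
have ar_le n : ar n <= n.+1%:R^-1.
  have p1 : (0 : R) < n.+1%:R by rewrite ltr0n.
  rewrite -[X in _ <= X]lnK ?posrE ?invr_gt0 // ler_expR lnV ?posrE // lerN2.
  by rewrite ler_peMl // ln_ge0 // ler1n.
have ar_dec n : 0 <= ar n.+1 <= ar n.
  rewrite expR_ge0 /= ler_expR lerN2 ler_wpM2l ?ler_ln ?posrE ?ltr0n ?ler_nat //.
  by rewrite (le_trans ler01).
pose g t : R := if (t <= Q)%N then delta * t%:R else Q%:R.
pose c n : R[i] := chi (1 + n%:Z).
have arC n : natcpow n.+1 (- sg%:C) = (ar n)%:C by rewrite natcpow_real.
apply: norm_limn_le => [|M].
  by rewrite !addr_ge0 ?mulr_ge0 // addr_ge0.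
have -> : series (fun n => chi n.+1 * natcpow n.+1 (- sg%:C)) M =
    \sum_(0 <= n < M) c n * (ar n)%:C.
  by rewrite /series /=; apply: eq_bigr => n _; rewrite arC /c -PoszD add1n.
have cn1 n : `|c n * (ar n)%:C| <= (n.+1%:R^-1)%:C.
  rewrite normrM -[X in _ <= X]mul1r; apply: ler_pM => //; first exact: chi1.
  by rewrite ger0_norm lecR ?ar_le ?expR_ge0.
have head K : (K <= N)%N -> `|\sum_(0 <= n < K) c n * (ar n)%:C| <= (1 + ln N%:R)%:C.
  move=> KN; apply: le_trans (ler_norm_sum _ _ _) _.
  apply: le_trans (ler_sum _ (fun n _ => cn1 n)) _.
  rewrite -rmorph_sum lecR big_mkord; apply: le_trans (harmonic_sum_le R N0).
  rewrite -(subnKC KN) big_split_ord /= lerDl sumr_ge0 // => n _.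
have [MN|/ltnW NM] := leqP M N.
  apply: le_trans (head _ MN) _; rewrite lecR.
  have : 0 <= delta * (1 + ln Q%:R) by rewrite mulr_ge0 // addr_ge0.
  lra.
rewrite (@big_cat_nat _ _ _ N) //=; apply: le_trans (ler_normD _ _) _.
have gN : g N <= N%:R.
  rewrite /g; case: leqP => [_|/ltnW]; last by rewrite ler_nat.
  by rewrite ler_piMl.
have tail : `|\sum_(N <= n < M) c n * (ar n)%:C| <= (2 + (delta * (1 + ln Q%:R) + 1))%:C.
  have := @abel_sum _ c (fun n => (ar n)%:C) (fun n => (g n)%:C) N M NM.
  have h1 n : (N <= n)%N -> `|\sum_(i < n) c i| <= (g n)%:C.
    rewrite /g => Nn; case: leqP => nQ; first by rewrite HN // Nn.
    by rewrite rmorph_nat HQ.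
  have h2 n : 0 <= (ar n.+1)%:C <= (ar n)%:C by rewrite !lecR.
  move=> /(_ h1 h2) H; apply: le_trans H _.
  have -> : (g N)%:C * (ar N)%:C *+ 2 + \sum_(N <= n < M) ((g n.+1)%:C - (g n)%:C) * (ar n)%:C =
     (g N * ar N *+ 2 + \sum_(N <= n < M) (g n.+1 - g n) * ar n)%:C.
    rewrite rmorphD rmorphMn rmorphM rmorph_sum /=; congr (_ + _).
    by apply: eq_bigr => n _; rewrite rmorphM rmorphB.
  rewrite lecR; apply: lerD.
    rewrite -mulr_natr -[X in _ <= X]mul1r ler_wpM2r //.
    apply: (@le_trans _ _ (N%:R * N.+1%:R^-1)).
      apply: ler_pM => //; last by rewrite expR_ge0.
      by rewrite /g; case: ifP => _; rewrite ?mulr_ge0.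
    by rewrite ler_pdivrMr ?ltr0n // mul1r ler_nat.
  pose tm n : R := (if (n < Q)%N then delta * n.+1%:R^-1 else 0) + (n == Q)%:R.
  have tm0 n : 0 <= tm n.
    by rewrite /tm addr_ge0 //; case: ifP => // _; rewrite mulr_ge0 ?invr_ge0.
  have term n : (g n.+1 - g n) * ar n <= tm n.
    rewrite /g /tm; case: (ltngtP n Q) => nQ.
    - rewrite addr0 -mulrBr -natrB // subSnn mulr1; apply: ler_pM => //.
      by rewrite expR_ge0.
    - by rewrite subrr mul0r addr0.
    rewrite nQ add0r; apply: (@le_trans _ _ (Q%:R * Q.+1%:R^-1)); last first.
      by rewrite ler_pdivrMr ?ltr0n // mul1r ler_nat.
    apply: ler_pM; rewrite ?expR_ge0 //.
      by rewrite subr_ge0 ler_piMl.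
    by rewrite gerBl mulr_ge0.
  apply: le_trans (ler_sum _ (fun n _ => term n)) _.
  apply: (@le_trans _ _ (\sum_(0 <= n < Q.+1 + M) tm n)).
    rewrite (@big_cat_nat _ _ _ N 0 (Q.+1 + M)) //=; last by rewrite (leq_trans NM) // leq_addl.
    rewrite (@big_cat_nat _ _ _ M N (Q.+1 + M)) //=; last by rewrite leq_addl.
    by rewrite addrCA lerDl addr_ge0 // sumr_ge0.
  rewrite (@big_cat_nat _ _ _ Q.+1) //= ?leq_addr // big_nat_recr //=.
  rewrite [X in _ + X]big_nat_cond [X in _ + X]big1 ?addr0; last first.
    move=> n /andP[/andP[Qn _] _]; rewrite /tm ltnNge (ltnW Qn) /= gtn_eqF // addr0.
    by [].
  rewrite {2}/tm ltnn eqxx add0r lerD2r.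
  rewrite (eq_big_nat _ _ (F2 := fun n => delta * n.+1%:R^-1)) => [|n /andP[_ nQ]]; last first.
    by rewrite /tm nQ ltn_eqF // addr0.
  by rewrite -mulr_sumr ler_wpM2l // big_mkord harmonic_sum_le.
by apply: le_trans (lerD (head N (leqnn N)) tail) _; rewrite -rmorphD lecR; lra.
Qed.

(** As [q ^ W] is about [d^(2/3)] with [d = D r0^2], the exceptional set has density about
    [D^(-1/3) r0^(4/3)] times a power of [q]. The lower bound on [D] makes this at most [1 / q]; the
    inequality is cubed to stay in integers. *)
Lemma sieve_loss (q k r W D d r0 x e : nat) :
  (7 < q)%N -> (0 < D)%N -> (k * r <= k ^ 3)%N -> (2 < k)%N ->
  d = (D * r0 ^ 2)%N -> ((q ^ W) ^ 3 <= q ^ 3 * d ^ 2)%N ->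
  (r0 ^ 4 * q ^ (24 * k ^ 3) <= D)%N -> (D <= x)%N ->
  (4 * q ^ (4 * (k * r) + W + k * 'C(k.+1, 2)) * (x %/ D + 1) * q <= x)%N.
Proof.
move=> q7 D0 kr k2 dE HU HD Dx.
have q0 : (0 < q)%N by apply: leq_trans q7.
have kC : (k * 'C(k.+1, 2) <= k ^ 3)%N.
  have c2 : (2 * 'C(k.+1, 2) = k.+1 * k)%N.
    elim: (k) => [|n IHn] //; rewrite binS bin1 mulnDr IHn; lia.
  rewrite -(leq_pmul2l (isT : 0 < 2)%N) mulnCA c2 !expnS expn0 muln1.
  rewrite [X in (_ <= X)%N]mulnCA leq_mul2l mulnA leq_mul2r.
  by apply/orP; right; apply/orP; right; lia.
have k3 : (27 <= k ^ 3)%N by rewrite -[27%N]/(3 ^ 3)%N leq_exp2r.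
pose U := (q ^ W)%N.
(* Four [k ^ 3] bound [4 * (k * r)], one bounds [k * 'C(k.+1, 2)], and the unit is the factor [q] to
   be saved. *)
pose e' := (5 * k ^ 3 + 1)%N.
have HDU : (8 * U * q ^ e' <= D)%N.
  rewrite -(@leq_exp2r _ _ 3) // !expnMn -(expnM _ _ 3).
  apply: (@leq_trans (q ^ 3 * (q ^ 3 * d ^ 2) * q ^ (e' * 3))).
    by rewrite leq_mul2r; apply/orP; right; apply: leq_mul => //; rewrite leq_exp2r.
  rewrite dE expnMn.
  apply: (@leq_trans (D ^ 2 * (r0 ^ 4 * (q ^ 3 * q ^ 3 * q ^ (e' * 3))))).
    by rewrite (expnM r0 2 2 : r0 ^ 4 = _)%N; apply: eq_leq; ring.
  rewrite [X in (_ <= X)%N]expnSr leq_mul2l; apply/orP; right.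
  apply: leq_trans HD; rewrite leq_mul2l -!expnD leq_pexp2l ?orbT // /e'.
  lia.
have xD : (x %/ D + 1 <= 2 * (x %/ D))%N by have := divn_gt0 x D0; rewrite Dx; lia.
have HE : (4 * (k * r) + W + k * 'C(k.+1, 2) + 1 <= W + e')%N by rewrite /e'; lia.
apply: (@leq_trans (D * (x %/ D))); last by rewrite mulnC leq_trunc_div.
apply: (@leq_trans (4 * q ^ (W + e') * (2 * (x %/ D)))).
  rewrite mulnAC leq_mul // -mulnA leq_mul2l /= -expnSr leq_pexp2l //.
  by rewrite -addn1.
rewrite mulnA leq_mul2r; apply/orP; right; apply: leq_trans HDU.
by rewrite expnD; apply: eq_leq; rewrite /U; ring.
Qed.

(** With [K = 6 h] the limit [2 K / 3] of [conductor_factor] is [4 h], and the two largest exponents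
    below it are [4 h - 2] and [4 h - 1]. For [q ^ W] about [d^(2/3)] the condition [d_small]
    reduces to [3 (h + 1) <= 4 h - 2], which is where [4 < h] comes from. *)
Lemma block_bound (C : numClosedFieldType) (Q : nat) (chi : int -> C) (h q : nat) :
  (0 < Q)%N ->
  (forall m n : int, (Q %| m - n)%Z -> chi m = chi n) ->
  (forall m n : int, chi (m * n) = chi m * chi n) ->
  (forall n : int, (chi n == 0) = ~~ coprimez n Q) ->
  (forall g : nat, (g %| Q)%N ->
    (forall m n : int, (g %| m - n)%Z -> chi m = chi n) ->
    (forall n : int, (chi n == 0) = ~~ coprimez n g) -> g = Q) ->
  let K := (6 * h)%N in let k := K.-1 in
  (4 < h)%N -> prime q -> (k ^ 3 < q)%N ->
  ((radical Q ^ 6 * q ^ (24 * k ^ 3)) ^ K <= Q)%N -> (Q <= 2 ^ 2 ^ k)%N ->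
  exists x : nat, [/\ (0 < x)%N, (x ^ K <= Q ^ 2 * (radical Q ^ 4 * q ^ 2) ^ K)%N &
    forall m, `|\sum_(i < x) chi (m + i%:Z)| <= (4 * k * x)%N%:R / q%:R].
Proof.
move=> Q0 chi_per chiM chi_eq0 chi_prim K k h4 q_pr kq HQ1 HQ2.
have K0 : (0 < K)%N by rewrite /K; lia.
have K2 : (1 < K)%N by rewrite /K; lia.
have j1k : (4 * h - 3 < k)%N by rewrite /k /K; lia.
have j2k : (4 * h - 2 < k)%N by rewrite /k /K; lia.
have j12' : (4 * h - 3).+1 = (4 * h - 2)%N by lia.
have jk : (k < (4 * h - 3).+1.*2)%N by rewrite /k /K; lia.
have jk2 : (k - (4 * h - 3) = 2 * h.+1)%N by rewrite /k /K; lia.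
have jh : (3 * h.+1 <= (4 * h - 3).+1)%N by lia.
have jK1 : (3 * (4 * h - 3).+1 < 2 * K)%N by rewrite /K; lia.
have jK2 : (3 * (4 * h - 2).+1 < 2 * K)%N by rewrite /K; lia.
have kK : k.+1 = K by rewrite /k prednK.
have k28 : (28 < k)%N by rewrite /k /K; lia.
have q0 := prime_gt0 q_pr; have q1 := prime_gt1 q_pr.
have q7 : (7 < q)%N.
  apply: leq_trans kq; apply: (@leq_trans (2 ^ 3)) => //; rewrite leqW // leq_exp2r //.
  by apply: leq_trans k28.
have [D [d [dE D0 DQ Qd Dd]]] := conductor_factor Q0 K0.
set r0 := radical Q in dE HQ1 *.
have r00 : (0 < r0)%N by exact: radical_gt0.
have d0 : (0 < d)%N by rewrite dE muln_gt0 D0 expn_gt0 r00.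
have DK : (D ^ K <= Q)%N by apply: dvdn_leq.
have QK : (Q <= d ^ K)%N by apply: dvdn_leq; rewrite ?expn_gt0 ?d0.
have HD : (r0 ^ 4 * q ^ (24 * k ^ 3) <= D)%N.
  rewrite -(@leq_pmul2r (r0 ^ 2)) ?expn_gt0 ?r00 // -dE -(@leq_exp2r _ _ K) //.
  apply: leq_trans QK; apply: leq_trans HQ1; rewrite leq_exp2r //.
  by apply: eq_leq; rewrite (expnD r0 4 2); ring.
have r0D : (r0 ^ 2 <= D)%N.
  apply: leq_trans HD; rewrite (expnD r0 2 2) -mulnA leq_pmulr // muln_gt0 !expn_gt0 r00 q0.
  by [].
have d_gt1 : (1 < d)%N.
  rewrite dE (leq_trans _ (leq_pmulr _ _)) ?expn_gt0 ?r00 //; apply: leq_trans HD.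
  apply: (@leq_trans (q ^ 1)); first by rewrite expn1.
  apply: leq_trans (leq_pmull _ _); last by rewrite expn_gt0 r00.
  by rewrite leq_pexp2l // muln_gt0 expn_gt0 (leq_trans _ k28).
have exW : exists W, (d ^ 2 <= q ^ (3 * W))%N.
  exists (d ^ 2)%N; apply: ltnW; apply: leq_trans (ltn_expl _ q1) _.
  by rewrite leq_pexp2l // leq_pmull.
have [W HW Wmin] := ex_minnP exW.
have W0 : (0 < W)%N.
  case: W HW {Wmin} => //; rewrite muln0 expn0 leqNgt.
  by rewrite (@leq_trans (2 ^ 2)) // leq_exp2r.
have HWm : (q ^ (3 * W.-1) < d ^ 2)%N.
  rewrite ltnNge; apply/negP => /Wmin; rewrite leqNgt prednK // leqnn.
  by [].
have HU : ((q ^ W) ^ 3 <= q ^ 3 * d ^ 2)%N.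
  rewrite -expnM mulnC -{1}(prednK W0) mulnS expnD leq_mul2l; apply/orP; right.
  exact: ltnW.
(* A crude bound, which suffices to take [t = k] in [valid_levels_exist] and so gives at most
   [k ^ 2] levels. *)
have W2k : (W < 2 ^ k * (k + 0))%N.
  have dQ : (d <= Q)%N.
    rewrite dE; apply: leq_trans DK; apply: (@leq_trans (D ^ 2)); first by rewrite expnS expn1 leq_mul2l r0D orbT.
    by rewrite leq_pexp2l.
  have : (2 ^ (3 * W.-1) < 2 ^ (2 ^ k * 2))%N.
    apply: (@leq_ltn_trans (q ^ (3 * W.-1))); first by case: (posnP (3 * W.-1)) => [->//|e0]; rewrite leq_exp2r.
    apply: leq_trans HWm _; rewrite expnM leq_exp2r //.
    exact: leq_trans dQ HQ2.
  rewrite ltn_exp2l // => H; have H2 : (2 ^ k * 2 <= 2 ^ k * k)%N by rewrite leq_mul2l (leq_trans _ k28) ?orbT.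
  rewrite addn0; move: W0 H H2; clear; move: (2 ^ k)%N (2 ^ k * k)%N => u v; lia.
have [ws [V wsz wl _]] := valid_levels_exist (ltn_trans (isT : (1 < 28)%N) k28) W0 W2k.
rewrite addn0 in wsz.
have kr : (k * size ws <= k ^ 3)%N by rewrite expnS expnS expn1 leq_mul2l wsz orbT.
pose j1 := Ordinal j1k; pose j2 := Ordinal j2k.
have j12 : (j1.+1 = j2)%N by [].
have Dd' : (D %| d)%N by rewrite dE dvdn_mulr.
(* This length makes the shifting error [2 d q ^ W] equal to [2 x / q]. *)
pose x := (d * q ^ W * q)%N.
have x0 : (0 < x)%N by rewrite !muln_gt0 d0 q0 expn_gt0 q0.
have Dx : (D <= x)%N.
  by rewrite (leq_trans (dvdn_leq d0 Dd')) // /x -mulnA leq_pmulr // muln_gt0 q0 expn_gt0 q0.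
exists x; split => //.
  have Uqd : (q ^ W <= q * d)%N.
    rewrite -(@leq_exp2r _ _ 3) // (leq_trans HU) // expnMn leq_mul2l leq_pexp2l ?orbT //.
  have xd : (x <= d ^ 2 * q ^ 2)%N.
    rewrite /x (leq_trans (leq_mul (leq_mul (leqnn d) Uqd) (leqnn q))) //.
    by apply: eq_leq; ring.
  apply: (@leq_trans ((d ^ 2 * q ^ 2) ^ K)); first by rewrite leq_exp2r.
  rewrite !expnMn [X in (_ <= X)%N]mulnA leq_mul2r; apply/orP; right.
  rewrite dE !expnMn; move: DK (r0 ^ K)%N; move: (D ^ K)%N => u uQ t.
  apply: (@leq_trans ((u * u) * (t * t * t * t))); first by apply: eq_leq; ring.
  apply: leq_trans (leq_mul (leq_mul uQ uQ) (leqnn _)) _.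
  by apply: eq_leq; ring.
move=> m.
have := short_sum_bound Q0 chi_per chiM chi_eq0 chi_prim q_pr
  (ltn_trans (isT : (1 < 28)%N) k28) V wl
  (leq_ltn_trans kr kq) D0 d0 Dd' (dvdn_trans (dvdn_exp K0 (dvdnn D)) DQ) _ j12 _ _ _ x m.
rewrite kK => /(_ Qd) H; apply: le_trans (H _ _ _) _.
- by rewrite -[X in (X <= _)%N]kK; exact: jk.
- rewrite [(k - j1)%N]jk2 expnM; apply: (@leq_trans ((q ^ (3 * W)) ^ h.+1)); first by rewrite leq_exp2r.
  rewrite -expnM leq_pexp2l // [(3 * W)%N]mulnC -mulnA leq_mul2l; apply/orP; right.
  exact: jh.
- move=> j jin e; apply: Dd; move: jin; by rewrite !inE => /orP[] /eqP ->.
have loss := sieve_loss (W := W) 0 q7 D0 kr (ltn_trans (isT : (2 < 28)%N) k28) dE HU HD Dx.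
have qC : 0 < q%:R :> C by rewrite ltr0n.
rewrite ler_pdivlMr // mulrDl mulfVK ?gt_eqF // -natrD -natrM -natrD ler_nat mulnDl.
have e1 : (2 * (d * q ^ W) * q = 2 * x)%N by rewrite /x; ring.
rewrite kK in loss; rewrite e1; apply: leq_trans (leq_add (leq_add (leqnn _) loss) (leqnn _)) _.
(* In units of [x / q]: 2 for the shift, 1 for the exceptional set, [2 K] for the threshold. *)
have kk : (2 + 1 + K.*2 <= 4 * k)%N by rewrite -kK; move: k28; clear; lia.
by rewrite -{2}[x]mul1n -!mulnDl leq_mul2r kk orbT.
Qed.

Section PrimitiveCharacter.

Variables (R : realType) (Q : nat) (chi : int -> R[i]).
Hypothesis Q_gt1 : (1 < Q)%N.
Hypothesis chi_prim : primitive_character Q chi.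

Let Q_gt0 : (0 < Q)%N := ltnW Q_gt1.

Lemma primitive_per (m n : int) : (Q %| m - n)%Z -> chi m = chi n.
Proof.
by rewrite -eqz_mod_dvd => /eqP; case: chi_prim => -[per _ _] _; apply: per.
Qed.

Lemma primitiveM (m n : int) : chi (m * n) = chi m * chi n.
Proof. by case: chi_prim => -[]. Qed.

Lemma primitive_eq0 (n : int) : (chi n == 0) = ~~ coprimez n Q.
Proof. by case: chi_prim => -[]. Qed.

Lemma primitive_modulus (g : nat) : (g %| Q)%N ->
  (forall m n : int, (g %| m - n)%Z -> chi m = chi n) ->
  (forall n : int, (chi n == 0) = ~~ coprimez n g) -> g = Q.
Proof.
move=> gQ per z; case: chi_prim => _; apply => //; split => //.
  by move=> m n mn; apply: per; rewrite -eqz_mod_dvd; apply/eqP.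
exact: primitiveM.
Qed.

Lemma primitive_norm_le1 n : `|chi n| <= 1.
Proof. exact: (char_norm_le1 Q_gt0 primitive_per primitiveM primitive_eq0). Qed.

Lemma primitive_nonprincipal : exists2 a, coprimez a Q & chi a != 1.
Proof.
apply: contrapT => H; have E n : coprimez n Q -> chi n = 1.
  move=> cn; apply/eqP/negPn/negP => ne; apply: H; by exists n.
have /(_ 1%N (fun=> 1)) := chi_prim.2.
rewrite dvd1n => /(_ isT) H1; have {}H1 : 1%N = Q.
  apply: H1 => //; split => // [m n|n]; first by rewrite mulr1.
  by rewrite oner_eq0 coprimezE coprimen1.
by move: Q_gt1; rewrite -H1.
Qed.

Lemma primitive_sum_le t : `|\sum_(i < t) chi (1 + i%:Z)| <= Q%:R.
Proof.
have [a ca na] := primitive_nonprincipal.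
have := @block_sum _ chi Q 0 1 t Q_gt0 primitive_norm_le1.
rewrite mul0rn add0r; apply => m.
by rewrite (sum_nonprincipal _ Q_gt0 primitive_per primitiveM ca na) normr0.
Qed.

(** This covers the range where [ln Q] is bounded in terms of [eps]. *)
Lemma dirichlet_L_trivial y : 3 < y ->
  `|dirichlet_L (1 + (ln y)^-1)%:C chi| <= (2 * ln (Q%:R : R) + 5)%:C.
Proof.
move=> y3.
have := @dirichlet_L_bound _ chi Q Q 1 y Q_gt0 Q_gt0 _ y3 primitive_norm_le1 primitive_sum_le.
rewrite ler01 lexx => /(_ isT) H; apply: le_trans (H _) _.
  move=> t _; apply: le_trans (ler_norm_sum _ _ _) _.
  apply: le_trans (ler_sum _ (fun i _ => primitive_norm_le1 _)) _.
  by rewrite sumr_const card_ord mul1r rmorph_nat.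
by rewrite lecR; lra.
Qed.

Lemma dirichlet_L_block (x k q : nat) y : 3 < y ->
  (0 < x)%N -> (0 < k)%N -> (5 * k <= q)%N -> 1 <= ln (Q%:R : R) <= q%:R ->
  (forall m, `|\sum_(i < x) chi (m + i%:Z)| <= (4 * k * x)%N%:R / q%:R) ->
  `|dirichlet_L (1 + (ln y)^-1)%:C chi| <= (ln x%:R + ln q%:R + 10 * k%:R + 4)%:C.
Proof.
move=> y3 x0 k0 kq /andP[lQ1 lQq] HB.
have q0 : (0 < q)%N by apply: leq_trans kq; rewrite muln_gt0.
have q0R : (0 : R) < q%:R by rewrite ltr0n.
(* Complete blocks account for [4 k / q]; the incomplete one is shorter than [x <= t / q] as soon as
   [t >= x * q], the starting point [N] below. *)
pose delta : R := (5 * k)%N%:R / q%:R.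
have d01 : 0 <= delta <= 1.
  by rewrite /delta divr_ge0 //= ler_pdivrMr // mul1r ler_nat.
have N0 : (0 < x * q)%N by rewrite muln_gt0 x0.
have := @dirichlet_L_bound _ chi Q (x * q) delta y Q_gt0 N0 d01 y3 primitive_norm_le1 primitive_sum_le.
move=> H; apply: le_trans (H _) _.
  move=> t /andP[xt _]; apply: le_trans (block_sum 1 t x0 primitive_norm_le1 HB) _.
  have -> : (delta * t%:R)%:C = (5 * k * t)%N%:R / q%:R :> R[i].
    by rewrite /delta mulrAC -natrM fmorph_div /= !rmorph_nat.
  have q0C : (0 : R[i]) < q%:R by rewrite ltr0n.
  rewrite ler_pdivlMr // mulrDl -mulrnAl mulfVK ?gt_eqF // -mulrnA -natrM -natrD ler_nat.
  apply: (@leq_trans (4 * k * t + t)).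
    by rewrite leq_add // -mulnA leq_mul2l [(x * _)%N]mulnC leq_trunc_div orbT.
  by rewrite -{2}[t]mul1n -mulnDl leq_mul2r; apply/orP; right; lia.
rewrite lecR natrM lnM ?posrE ?ltr0n // !lerD2r lerD2l.
rewrite /delta mulrAC ler_pdivrMr // natrM -mulrA.
have k0R : (0 : R) <= k%:R by [].
have : (k%:R : R) * (1 + ln Q%:R) <= k%:R * (2 * q%:R) by apply: ler_wpM2l => //; lra.
lra.
Qed.

End PrimitiveCharacter.

(** * Choice of the parameters *)

Lemma half_le_ln2 (R : realType) : 2^-1 <= ln (2 : R).
Proof.
have : ln (1 + - 2^-1 : R) <= - 2^-1 by apply: le_ln1Dx; lra.
have -> : 1 + - 2^-1 = 2^-1 :> R by lra.
by rewrite lnV ?posrE //; lra.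
Qed.

Lemma ln_block_length (R : realType) (x K Q r q : nat) :
  (0 < x)%N -> (0 < K)%N -> (0 < Q)%N -> (0 < r)%N -> (0 < q)%N ->
  (x ^ K <= Q ^ 2 * (r ^ 4 * q ^ 2) ^ K)%N ->
  ln (x%:R : R) <= 2 * ln Q%:R / K%:R + 4 * ln r%:R + 2 * ln q%:R.
Proof.
move=> x0 K0 Q0 r0 q0 H.
have KR : (0 : R) < K%:R by rewrite ltr0n.
have : ln ((x ^ K)%N%:R : R) <= ln ((Q ^ 2 * (r ^ 4 * q ^ 2) ^ K)%N%:R).
  by rewrite ler_ln ?posrE ?ltr0n ?ler_nat // ?muln_gt0 ?expn_gt0 ?muln_gt0 ?expn_gt0 ?x0 ?Q0 ?r0 ?q0.
rewrite !(natrX, natrM) lnM ?posrE ?exprn_gt0 ?mulr_gt0 ?exprn_gt0 ?ltr0n //.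
rewrite !lnXn ?mulr_gt0 ?exprn_gt0 ?ltr0n // lnM ?posrE ?exprn_gt0 ?ltr0n //.
rewrite !lnXn ?ltr0n // => {}H.
rewrite -(ler_pM2l KR) !mulrDr [K%:R * (_ / _)]mulrC divfK ?gt_eqF //.
rewrite -addrA -mulrDr; move: H.
rewrite -[ln x%:R *+ K]mulr_natl -[ln Q%:R *+ 2]mulr_natl -[ln r%:R *+ 4]mulr_natl
  -[ln q%:R *+ 2]mulr_natl -[(_ + _) *+ K]mulr_natl => G; exact: G.
Qed.

(** Together with [ln Q <= h ^ 8] this yields the bound [Q <= 2 ^ 2 ^ k] that limits the number of
    levels. *)
Lemma leq_pow8_exp2 h : (3 < h)%N -> (2 * h ^ 8 <= 2 ^ (6 * h).-1)%N.
Proof.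
move=> h3; have h2 : (h ^ 2 <= 2 ^ h)%N.
  rewrite -(subnK h3); elim: (h - 4)%N => // n IH.
  rewrite addSn (expnS 2) mul2n -addnn; apply: leq_trans (leq_add IH IH).
  by rewrite !expnS expn0 !muln1; lia.
apply: (@leq_trans (2 ^ (4 * h).+1)); last by rewrite leq_pexp2l //; lia.
by rewrite (expnS 2) leq_mul2l /= [(4 * h)%N]mulnC expnM (expnM h 2 4 : h ^ 8 = _)%N leq_exp2r.
Qed.

(** [kap] bounds [K], and [Y ^+ 4] will be [ln Q]. In the last clause the two terms are constants
    times [Y^4 / X] and [Y^4 / (eta X^3)], so the powers of [X] pay for all constants and for
    [ln q]. *)
Lemma scale_bounds (R : realType) (eta X Y : R) :
  0 < eta -> 0 < Y -> 1000 <= X -> 1000 <= X * eta -> X ^+ 2 <= Y ->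
  let T := Y / X in let kap := 12 * T in
  [/\ T * X = Y, X <= T, Y <= T ^+ 2, kap ^+ 3 <= Y ^+ 4 &
      kap * (12 * Y ^+ 3 + 24 * kap ^+ 3 * (9 * (X / eta))) <= Y ^+ 4].
Proof.
move=> eta0 Y0 X1 Xe XY T kap.
have X0 : 0 < X by lra.
have TX : T * X = Y by rewrite mulfVK // gt_eqF.
have XT : X <= T by rewrite ler_pdivlMr // -expr2.
have T0 : 0 < T by apply: lt_le_trans XT.
have YT : Y <= T ^+ 2 by rewrite -[leLHS]TX expr2 ler_wpM2l // ltW.
have X2 : X <= X ^+ 2 by rewrite expr2 ler_peMr //; lra.
have Y1 : 1 <= Y by lra.
pose s := 12 / X.
have s0 : 0 <= s by rewrite divr_ge0 // ltW.
have s50 : s <= 50^-1 by rewrite ler_pdivrMr //; lra.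
have kapE : kap = s * Y by rewrite /kap /s /T; ring.
have se : s / eta <= 50^-1.
  by rewrite /s -mulrA -invfM ler_pdivrMr ?mulr_gt0 //; lra.
have Yn n : 0 <= Y ^+ n by rewrite exprn_ge0 // ltW.
split => //.
  rewrite kapE exprMn [Y ^+ 4]exprS; apply: ler_wpM2r => //.
  apply: (@le_trans _ _ 1) => //; rewrite exprn_ile1 //; lra.
have e1 : kap * (12 * Y ^+ 3) <= 2^-1 * Y ^+ 4.
  rewrite kapE (_ : s * Y * _ = 12 * s * Y ^+ 4); last by ring.
  apply: ler_wpM2r => //; lra.
have e2 : kap * (24 * kap ^+ 3 * (9 * (X / eta))) <= 2^-1 * Y ^+ 4.
  have sX : s * X = 12 by rewrite mulfVK // gt_eqF.
  rewrite [leLHS](_ : _ = 216 * (s ^+ 2 * (s / eta) * (s * X)) * Y ^+ 4); last by rewrite kapE; ring.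
  rewrite sX; apply: ler_wpM2r => //.
  have : s ^+ 2 * (s / eta) <= 50^-1 ^+ 2 * 50^-1.
    apply: ler_pM => //; [exact: exprn_ge0|by rewrite divr_ge0 // ltW|].
    by rewrite lerXn2r ?nnegrE.
  lra.
rewrite mulrDr; lra.
Qed.

Lemma exists_prime_near (R : realType) (l : R) : 7 <= l ->
  exists M q : nat, [/\ l < M%:R, (M < q)%N, prime q & ln (q%:R : R) <= 7 + 2 * ln l].
Proof.
move=> l7; have l0 : 0 < l by lra.
pose M := (Num.trunc l).+1.
have /andP[Ml1 Ml2] := truncn_itv (ltW l0).
have ME : (M%:R : R) = (Num.trunc l)%:R + 1 by rewrite natr1.
have lM : l < M%:R by [].
have M6 : (6 < M)%N by rewrite -(ltr_nat R); lra.
have [q q_pr /andP[Mq qM]] := exists_prime_between M6.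
exists M, q; split => //.
have q8 : (q%:R : R) <= 8 * l ^+ 2.
  apply: (@le_trans _ _ ((2 * M ^ 2)%N%:R)); first by rewrite ler_nat.
  rewrite natrM natrX; have : (M%:R : R) ^+ 2 <= (2 * l) ^+ 2.
    by apply: lerXn2r; rewrite ?nnegrE // ?mulr_ge0 // ?ltW // ME; lra.
  by rewrite exprMn; lra.
apply: (@le_trans _ _ (ln (8 * l ^+ 2))).
  by rewrite ler_ln ?posrE ?ltr0n ?prime_gt0 // mulr_gt0 // exprn_gt0.
rewrite lnM ?posrE ?exprn_gt0 // lnXn // -[ln l *+ 2]mulr_natl lerD2r.
have -> : 8 = 1 + 7 :> R by lra.
by apply: le_ln1Dx; lra.
Qed.

Lemma leq_expM_ln (R : realType) (r q a K Q : nat) :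
  (0 < r)%N -> (0 < q)%N -> (0 < Q)%N ->
  K%:R * (6 * ln r%:R + a%:R * ln q%:R) <= ln (Q%:R : R) ->
  ((r ^ 6 * q ^ a) ^ K <= Q)%N.
Proof.
move=> r0 q0 Q0 H.
have p6 : (0 < r ^ 6)%N by rewrite expn_gt0 r0.
have pa : (0 < q ^ a)%N by rewrite expn_gt0 q0.
have pm : (0 < r ^ 6 * q ^ a)%N by rewrite muln_gt0 p6.
rewrite -(ler_nat R) -ler_ln ?posrE ?ltr0n // ?expn_gt0 ?pm //.
apply: le_trans H; rewrite natrX lnXn ?ltr0n // natrM lnM ?posrE ?ltr0n //.
rewrite !natrX !lnXn ?ltr0n // -[_ *+ K]mulr_natl.
by rewrite -[ln r%:R *+ 6]mulr_natl -[ln q%:R *+ a]mulr_natl.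
Qed.

Lemma leq_exp2_exp2_ln (R : realType) (Q k m : nat) :
  (0 < Q)%N -> (2 * m <= 2 ^ k)%N -> ln (Q%:R : R) <= m%:R -> (Q <= 2 ^ 2 ^ k)%N.
Proof.
move=> Q0 mk H; have p2 : (0 < 2 ^ 2 ^ k)%N by rewrite expn_gt0.
rewrite -(ler_nat R) -ler_ln ?posrE ?ltr0n // natrX lnXn //.
rewrite -[ln 2 *+ _]mulr_natl; set v := (2 ^ k)%N in mk *.
apply: le_trans H _; apply: (@le_trans _ _ (v%:R * 2^-1)).
  by rewrite ler_pdivlMr // -natrM ler_nat mulnC.
by rewrite ler_wpM2l // half_le_ln2.
Qed.

(** 133 is [1 + 8 + 120 + 4], from the terms in [l / K], [lr], [k] and the constant; [27 / eta]
    comes from [lq]. *)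
Lemma final_bound (R : realType) (eta X Y l lr lq T K k : R) :
  0 < eta -> 1 <= X -> 1 <= Y -> T * X = Y -> 0 < T -> l = Y ^+ 4 ->
  lr <= 2 * Y ^+ 3 -> lq <= 9 * (X / eta) -> 6 * T <= K -> k <= 12 * T ->
  2 * l / K + 4 * lr + 3 * lq + 10 * k + 4 <= (133 + 27 / eta) * (Y ^+ 3 * X).
Proof.
move=> eta0 X1 Y1 TX T0 lY rY qX TK kT; have X0 : 0 < X by lra.
have Y0 : 0 < Y by lra.
have Y31 : 1 <= Y ^+ 3 by exact: exprn_ege1.
set Z := Y ^+ 3 * X.
have Z1 : 1 <= Z by rewrite -[1]mulr1; apply: ler_pM => //; lra.
have ZX : X <= Z by rewrite ler_peMl // ltW.
have ZY : Y ^+ 3 <= Z by rewrite ler_peMr //; lra.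
have ZT : T <= Z.
  apply: le_trans ZY; apply: (@le_trans _ _ Y); first by rewrite -TX ler_peMr // ltW.
  by rewrite exprS ler_peMr ?exprn_ege1 // ltW.
have b1 : 2 * l / K <= Z.
  rewrite ler_pdivrMr; last by lra.
  apply: (@le_trans _ _ (Z * (6 * T))); last by rewrite ler_wpM2l //; lra.
  rewrite lY (_ : Z * (6 * T) = 6 * (Y ^+ 3 * (T * X))); last by rewrite /Z; ring.
  rewrite TX -exprSr ler_wpM2r ?exprn_ge0 // ?ltW //; lra.
have b2 : 3 * lq <= 27 / eta * Z.
  apply: (@le_trans _ _ (27 / eta * X)); last by rewrite ler_wpM2l // divr_ge0 // ltW.
  rewrite (_ : 27 / eta * X = 3 * (9 * (X / eta))); last by ring.
  by rewrite ler_wpM2l.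
rewrite mulrDl; lra.
Qed.

(* With [l = ln Q], [Y = l^(1/4)] and [X = l^eta], the number of variables per level is
   of order [Y / X] and the auxiliary prime satisfies [l <= q <= 8 l^2]. *)
Lemma choose_parameters (R : realType) (eta : R) (Q : nat) :
  0 < eta <= 8^-1 -> (0 < Q)%N -> 1 <= ln (Q%:R : R) ->
  let X := expR (eta * ln (ln (Q%:R : R))) in let Y := expR (ln (ln (Q%:R : R)) / 4) in
  1000 / eta <= X -> ln ((radical Q)%:R : R) <= 2 * Y ^+ 3 ->
  exists h q : nat, let K := (6 * h)%N in let k := K.-1 in
    [/\ (4 < h)%N, prime q, (k ^ 3 < q)%N,
        ((radical Q ^ 6 * q ^ (24 * k ^ 3)) ^ K <= Q)%N & (Q <= 2 ^ 2 ^ k)%N ] /\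
    [/\ ln (Q%:R : R) <= q%:R, (5 * k <= q)%N &
      2 * ln (Q%:R : R) / K%:R + 4 * ln ((radical Q)%:R) + 3 * ln q%:R + 10 * k%:R + 4 <=
        (133 + 27 / eta) * (Y ^+ 3 * X)].
Proof.
move=> /andP[eta0 eta8] Q0 l1; set l := ln (Q%:R : R) in l1 *; set u := ln l => X Y XA rY.
have l0 : 0 < l by lra.
have u0 : 0 <= u by rewrite ln_ge0.
have Y0 : 0 < Y by exact: expR_gt0.
have Y1 : 1 <= Y by rewrite -expR0 ler_expR divr_ge0.
have lY : l = Y ^+ 4 by rewrite -expRM_natl mulrCA divff // mulr1 lnK.
have XY : X ^+ 2 <= Y.
  rewrite -expRM_natl ler_expR mulrA [u / 4]mulrC ler_wpM2r //; lra.
have uX : 1 + eta * u <= X by exact: expR_ge1Dx.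
have XA' : 1000 <= X * eta by rewrite -ler_pdivrMr.
have X1 : 1000 <= X.
  by apply: le_trans XA' _; rewrite ler_piMr // ?expR_ge0 //; lra.
have [] := scale_bounds eta0 Y0 X1 XA' XY.
set T := Y / X => TX XT YT kapl kapb.
have T0 : 0 < T by lra.
have [M [q [lM Mq q_pr lnq]]] : exists M q : nat,
    [/\ l < M%:R, (M < q)%N, prime q & ln (q%:R : R) <= 7 + 2 * ln l].
  apply: exists_prime_near; apply: (@le_trans _ _ Y).
    by apply: le_trans XY; apply: (@le_trans _ _ X); [lra|rewrite expr2 ler_peMr ?expR_ge0 //; lra].
  by rewrite lY exprS ler_peMr ?exprn_ege1 // ltW.
have q0 := prime_gt0 q_pr.
have lq : l <= q%:R by apply: ltW; apply: lt_trans lM _; rewrite ltr_nat.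
have {}lnq : ln (q%:R : R) <= 9 * (X / eta).
  apply: le_trans lnq _; rewrite -/u mulrA ler_pdivlMr // mulrDl -mulrA [u * eta]mulrC; lra.
have lnq0 : 0 <= ln (q%:R : R) by rewrite ln_ge0 // ler1n.
have lnr0 : 0 <= ln ((radical Q)%:R : R) by rewrite ln_ge0 // ler1n radical_gt0.
clear uX XA XA' eta8 u0 XY.
pose h := (Num.trunc T).+1.
have /andP[hT1 hT2] := truncn_itv (ltW T0).
have Th : T <= h%:R by exact: ltW.
have hE : (h%:R : R) = (Num.trunc T)%:R + 1 by rewrite natr1.
have hT : h%:R <= 2 * T by rewrite hE; lra.
have h4 : (4 < h)%N by rewrite -(ltr_nat R); lra.
clear hT1 hT2 hE; move: h Th hT h4 => h Th hT h4.
pose K := (6 * h)%N; pose k := K.-1.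
have kK : (k.+1 = K)%N by rewrite /k prednK // muln_gt0 (leq_trans _ h4).
have KT : 6 * T <= K%:R by rewrite natrM; lra.
have TK : K%:R <= 12 * T by rewrite natrM; lra.
have k12 : (k%:R : R) <= 12 * T by apply: le_trans TK; rewrite ler_nat -kK.
have k3R : ((k ^ 3)%N%:R : R) <= (12 * T) ^+ 3.
  by rewrite natrX lerXn2r ?nnegrE // mulr_ge0 // ltW.
have kM : (k ^ 3 < M)%N.
  by rewrite -(ltr_nat R); apply: le_lt_trans lM; apply: le_trans k3R _; rewrite lY.
exists h, q; rewrite -/K -/k; split; split => //.
- exact: ltn_trans kM Mq.
- apply: (@leq_expM_ln R); rewrite ?radical_gt0 // -/l lY.
  apply: le_trans kapb; apply: ler_pM => //.
    by rewrite addr_ge0 ?mulr_ge0.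
  apply: lerD; first by rewrite -(_ : 6 * (2 * Y ^+ 3) = 12 * Y ^+ 3) ?ler_wpM2l //; ring.
  apply: ler_pM => //.
  by rewrite natrM ler_wpM2l.
- apply: (@leq_exp2_exp2_ln R Q k (h ^ 8)) => //; first by rewrite leq_pow8_exp2 // ltnW.
  rewrite -/l lY natrX; apply: (@le_trans _ _ (T ^+ 8)).
    rewrite (exprM T 2 4 : T ^+ 8 = _).
    by apply: lerXn2r; rewrite ?nnegrE ?exprn_ge0 // ltW.
  by apply: lerXn2r; rewrite ?nnegrE // ltW.
- have k5 : (5 <= k ^ 2)%N.
    apply: (@leq_trans (3 ^ 2)) => //; rewrite leq_exp2r // -ltnS kK.
    by rewrite (@leq_trans (6 * 1)) // leq_mul2l /= (leq_trans _ h4).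
  apply: leq_trans (ltnW Mq); apply: leq_trans (ltnW kM).
  by rewrite [(k ^ 3)%N]expnSr leq_mul2r k5 orbT.
apply: (final_bound (T := T)) => //; lra.
Qed.

Theorem lemma5 (R : realType) :
  exists Q0 : nat,
  forall eps : R, 0 < eps ->
  exists2 C : R, 0 < C &
  forall Q : nat, (Q0 <= Q)%N ->
    (radical Q)%:R <= expR (2 * ln (Q%:R : R) `^ (3 / 4)) ->
  forall chi : int -> R[i], primitive_character Q chi ->
  forall y : R, 3 < y ->
    `| dirichlet_L (1 + (ln y)^-1)%:C chi | <= (C * ln (Q%:R : R) `^ (3 / 4 + eps))%:C.
Proof.
(* From 4 on, [ln Q >= 2 ln 2 >= 1]. *)
exists 4%N => eps eps0.
(* The cap [1/8] ensures [X ^+ 2 <= Y] for [X = l^eta] and [Y = l^(1/4)]. *)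
pose eta : R := Num.min eps 8^-1.
have eta0 : 0 < eta by rewrite lt_min eps0 /=; lra.
have eta8 : eta <= 8^-1 by rewrite ge_min lexx orbT.
have etae : eta <= eps by rewrite ge_min lexx.
pose A : R := 1000 / eta.
have A0 : 0 < A by apply: divr_gt0 eta0; rewrite ltr0n.
(* The value of [ln Q] at which [X] reaches [A]. *)
pose lmax := expR (ln A / eta).
have c1 : 0 <= 27 / eta by apply: divr_ge0; [rewrite ler0n|apply: ltW].
have lmax0 : 0 < lmax by exact: expR_gt0.
exists (133 + 27 / eta + (2 * lmax + 5)); first lra.
move=> Q Q4 radQ chi prim y y3.
have Q1 : (1 < Q)%N by apply: leq_trans Q4.
have Q0 : (0 < Q)%N by apply: ltnW.
have l1 : 1 <= ln (Q%:R : R).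
  apply: (@le_trans _ _ (ln 4)); last by rewrite ler_ln ?posrE ?ltr0n // ler_nat.
  have -> : 4 = 2 * 2 :> R by lra.
  rewrite lnM ?posrE //; have := half_le_ln2 R; lra.
set l := ln (Q%:R : R) in l1 radQ *.
have l0 : 0 < l by lra.
have powE t : l `^ t = expR (t * ln l) by rewrite /powR gt_eqF.
set X := expR (eta * ln l); set Y := expR (ln l / 4).
have u0 : 0 <= ln l by rewrite ln_ge0.
have Y3 : l `^ (3 / 4) = Y ^+ 3.
  by rewrite powE /Y -expRM_natl; congr expR; ring.
have YX : Y ^+ 3 * X <= l `^ (3 / 4 + eps).
  rewrite -Y3 !powE -expRD ler_expR -mulrDl ler_wpM2r // lerD2l //.
have Z1 : 1 <= Y ^+ 3 * X.
  rewrite -[1]mulr1; apply: ler_pM => //; last by rewrite -expR0 ler_expR mulr_ge0 // ltW.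
  by apply: exprn_ege1; rewrite -expR0 ler_expR divr_ge0.
set C := _ + (2 * lmax + 5).
apply: (@le_trans _ _ (C * (Y ^+ 3 * X))%:C); last first.
  by rewrite lecR ler_wpM2l // /C; lra.
have [XA|XA] := leP A X; last first.
  apply: le_trans (dirichlet_L_trivial Q1 prim y3) _; rewrite lecR -/l.
  have ll : l <= lmax.
    rewrite /lmax -[l]lnK // ler_expR ler_pdivlMr // mulrC.
    by rewrite -[eta * _]expRK ler_ln ?posrE ?expR_gt0 // ltW.
  apply: (@le_trans _ _ (C * 1)); last by rewrite ler_wpM2l // /C; lra.
  by rewrite mulr1 /C; lra.
have rY : ln ((radical Q)%:R : R) <= 2 * Y ^+ 3.
  rewrite -Y3 -[X in _ <= X]expRK ler_ln ?posrE ?expR_gt0 ?ltr0n ?radical_gt0 //.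
have eta08 : 0 < eta <= 8^-1 by rewrite eta0.
have [h [q [[h4 q_pr kq HQ1 HQ2] [lq kq5 fin]]]] := choose_parameters eta08 Q0 l1 XA rY.
have [x [x0 xK Hx]] := block_bound Q0 (primitive_per prim) (primitiveM prim)
  (primitive_eq0 prim) (primitive_modulus prim) h4 q_pr kq HQ1 HQ2.
have q0 := prime_gt0 q_pr.
have hpos : (0 < h)%N by exact: leq_ltn_trans h4.
have k0 : (0 < (6 * h).-1)%N by rewrite -(prednK hpos) mulnS.
have lQ : 1 <= ln (Q%:R : R) <= q%:R by rewrite l1.
apply: le_trans (dirichlet_L_block Q1 prim y3 x0 k0 kq5 lQ Hx) _; rewrite lecR.
have K0 : (0 < 6 * h)%N by rewrite muln_gt0 hpos.
have lx := ln_block_length R x0 K0 Q0 (radical_gt0 Q) q0 xK.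
apply: (@le_trans _ _ ((133 + 27 / eta) * (Y ^+ 3 * X))); last first.
  by rewrite ler_wpM2r ?(le_trans ler01) // /C; lra.
by apply: le_trans fin; rewrite -/l in lx *; lra.
Qed.
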